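(* For every $K>0$ there exist constants $c>0$ and $c_0>0$, independent of $m$, $k$ and $\delta$, such that the following holds. Let $k,m$ be positive integers with $m/k>3$, let $\delta>0$, and let $x\in\mathbb{R}^k$ be fixed with $\|x\|=1$. Suppose that $E\in\mathbb{R}^{m\times k}$ is a random matrix whose entries are centered i.i.d. sub-Gaussian random variables with variance one and sub-Gaussian norm not exceeding $K$, and let $\mu=\frac1m\|\mathbb{E}E^T(Ex-Q(Ex))\|$. Then for every $C\in\mathbb{N}$, $$\mu\ \ge\ 2\left(e^{-\frac{2\pi^2}{\delta^2}}-e^{-\frac{8\pi^2}{\delta^2}}\right)-\frac13c_0\|x\|_3^3\,C(2C+1)(2C+5)\delta^2-e\frac{K^2}{c}\exp\left(-\frac{cC^2\delta^2}{K^2}\right)-4\exp\left(-\frac{C^2\delta^2}{2}\right).$$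
   Context: $\|\cdot\|$ is the Euclidean norm and $\|x\|_3=(\sum_i|x_i|^3)^{1/3}$. For $\delta>0$, the uniform scalar quantizer $q_\delta:\mathbb{R}\to\delta\mathbb{Z}$ is $q_\delta(t)=n\delta$ if $t\in(n\delta-\delta/2,\,n\delta+\delta/2]$, $n\in\mathbb{Z}$; $Q=Q_\delta^{\rm MSQ}:\mathbb{R}^m\to(\delta\mathbb{Z})^m$ applies $q_\delta$ to each coordinate. The sub-Gaussian norm of a real random variable $z$ is $\|z\|_{\psi_2}=\sup_{p\ge1}p^{-1/2}(\mathbb{E}|z|^p)^{1/p}$, and $z$ is sub-Gaussian if it is finite. *)

(* Defs.v *)
From HB Require Import structures.
From mathcomp Require Import all_boot all_order all_algebra.
From mathcomp Require Import all_classical all_reals all_analysis.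
From mathcomp Require Import lra.

Set Implicit Arguments.
Unset Strict Implicit.
Unset Printing Implicit Defensive.

Import Order.TTheory GRing.Theory Num.Theory.

Local Open Scope classical_set_scope.
Local Open Scope ring_scope.

(* The library norm `|x| on matrices is the sup norm, hence these definitions. *)
Definition enorm (R : realType) n (x : 'cV[R]_n) : R :=
  Num.sqrt (\sum_i x i 0 ^+ 2).

Definition norm3 (R : realType) n (x : 'cV[R]_n) : R :=
  (\sum_i `|x i 0| ^+ 3) `^ (3^-1).

(* The rounding convention n * delta - delta / 2 < t <= n * delta + delta / 2
   is n = ceil (t / delta - 1/2) for delta > 0; see quantizerE. *)
Definition quantizer (R : realType) (delta t : R) : R :=
  (Num.ceil (t / delta - 2^-1))%:~R * delta.

Lemma quantizerE (R : realType) (delta t : R) (n : int) : 0 < delta ->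
  n%:~R * delta - delta / 2 < t <= n%:~R * delta + delta / 2 ->
  quantizer delta t = n%:~R * delta.
Proof.
move=> d0 /andP[lo hi]; congr (_%:~R * _); apply: ceil_def.
have lo' : n%:~R - 2^-1 < t / delta.
  by rewrite ltr_pdivlMr // mulrBl [2^-1 * _]mulrC.
have hi' : t / delta <= n%:~R + 2^-1.
  by rewrite ler_pdivrMr // mulrDl [2^-1 * _]mulrC.
by rewrite intrB; apply/andP; split; lra.
Qed.

Definition msq (R : realType) (delta : R) n (y : 'cV[R]_n) : 'cV[R]_n :=
  map_mx (quantizer delta) y.

Section random.
Context d (T : measurableType d) (R : realType) (P : probability T R).

Definition psi2_norm (z : T -> R) : \bar R :=
  ereal_sup [set ((p `^ (- 2^-1))%:E * 'N[P]_p%:E[EFin \o z])%E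
            | p in [set p : R | 1 <= p]].

Definition sub_gaussian (z : T -> R) : Prop := (psi2_norm z < +oo)%E.

Definition mutually_independent (I : finType) (X : I -> {RV P >-> R}) : Prop :=
  forall (J : {set I}) (A : I -> set R),
    (forall i, i \in J -> measurable (A i)) ->
    P (\bigcap_(i in [set` J]) (X i @^-1` A i)) =
      (\prod_(i in J) P (X i @^-1` A i))%E.

Definition identically_distributed (I : finType) (X : I -> {RV P >-> R}) :
    Prop :=
  forall (i j : I) (A : set R), measurable A ->
    distribution P (X i) A = distribution P (X j) A.

Definition iid (I : finType) (X : I -> {RV P >-> R}) : Prop :=
  mutually_independent X /\ identically_distributed X.

Definition realize m n (E : 'M[{RV P >-> R}]_(m, n)) (w : T) : 'M[R]_(m, n) :=
  map_mx (fun X : {RV P >-> R} => X w) E.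

(* fine sends an infinite expectation to 0. In msq_mu every entry is dominated
   by (delta / 2) * \sum_i `|E i j|, hence has a finite expectation as soon as
   the entries of E are integrable. *)
Definition mx_expectation m n (V : T -> 'M[R]_(m, n)) : 'M[R]_(m, n) :=
  \matrix_(i, j) fine ('E_P[fun w => V w i j])%E.

Definition msq_mu m k (E : 'M[{RV P >-> R}]_(m, k)) (delta : R)
    (x : 'cV[R]_k) : R :=
  m%:R^-1 * enorm (mx_expectation (fun w =>
    (realize E w)^T *m (realize E w *m x - msq delta (realize E w *m x)))).

End random.

(* Main.v *)
(* For one row put Z = \sum_j x_j e_j and s(z) = z - q_delta(z).  Since |x| = 1,
   Cauchy-Schwarz gives mu >= <x, mean vector>, an average of the numbers
   E[Z s(Z)] over the rows.  The error s is a sawtooth of period delta, so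
   E[Z s(Z)] is formally \sum_k 2 (-1)^(k+1) E[Z sin(t_k Z)] / t_k with
   t_k = 2 pi k / delta, and E[Z sin(t Z)] is close to t exp(- t^2 / 2), its value
   for a standard Gaussian; the alternating sum \sum_k 2 (-1)^(k+1) exp(- t_k^2 / 2)
   is at least its first two terms.  Neither Poisson summation nor a Berry-Esseen
   theorem is needed.

   To keep the frequencies below T = O(1 / eps), eps = \sum_j |x_j|^3, where the
   characteristic function of Z is controlled by the third moments (hence by K), s
   is replaced by a trigonometric polynomial of degree N ~ delta / eps with smooth
   coefficients.  The pointwise error of this replacement is dominated by N^-2
   times a sum of two shifted Fejer kernels, whose expectation against 1 + Z^2 is
   O(N) by the same bounds.  The outcome is
     E[Z s(Z)] >= 2 (exp(- 2 pi^2 / delta^2) - exp(- 8 pi^2 / delta^2))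
                  - M eps (1 + delta^2)
   with M depending only on K.  If C delta >= 1, then C^3 delta^2 dominates 1,
   delta^2 and 1 / delta, so the c0 term absorbs the error; if C delta < 1, the
   right-hand side of the theorem is nonpositive for c = K^2 / 2. *)

Require Import Defs.
From HB Require Import structures.
From mathcomp Require Import all_boot all_order all_algebra.
From mathcomp Require Import all_classical all_reals all_analysis.
From mathcomp Require Import measurable_realfun complex ring lra.

Set Implicit Arguments.
Unset Strict Implicit.
Unset Printing Implicit Defensive.

Import Order.TTheory GRing.Theory Num.Theory.
Import numFieldNormedType.Exports.

Local Open Scope classical_set_scope.
Local Open Scope ring_scope.

(** * Independence *)

Import HBSimple HBNNSimple.

(** Only third moments are controlled, so [Z] may well have atoms and its characteristic function is
    known to be small only for frequencies below about 1 / (rho eps). The sawtooth must therefore be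
    compared with trigonometric polynomials of limited degree N, both in the approximation and in
    the majorant of its error. A sharply truncated Fourier series has error of order 1 / (N d) at
    distance d from the jump, too slow for a Fejer kernel over N^2. The cubic cutoff cures this: two
    summations by parts bound the kernel by a multiple of N (N d + 1)^-3, and one integration gives
    (N d + 1)^-2, the profile of a Fejer kernel over N^2. The error is multiplied by [Z], and |Z| is
    replaced by (1 + Z^2) / 2 because a polynomial weight still splits into products over the
    independent coordinates. Among the N^2 frequency pairs of a Fejer kernel essentially only the N
    diagonal ones count, so the error is of order (delta / N) (1 + delta^2); taking N as large as
    the frequency limit allows turns delta / N into a multiple of rho eps. *)

Section independence.
Context d (T : measurableType d) (R : realType) (P : probability T R).

(** The usual passage from indicators to simple functions to monotone limits. In the application [g]
    is the product of the factors at the other coordinates and [c] is its expectation. *)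
Lemma ge0_integral_comp_weight (X : {RV P >-> R}) (g : T -> R) (c : R) :
    measurable_fun setT g -> (forall w, 0 <= g w) -> 0 <= c ->
    (forall A, measurable A ->
      \int[P]_w (\1_A (X w) * g w)%:E = \int[P]_w (\1_A (X w))%:E * c%:E)%E ->
  forall f : R -> R, measurable_fun setT f -> (forall y, 0 <= f y) ->
  (\int[P]_w (f (X w) * g w)%:E = \int[P]_w (f (X w))%:E * c%:E)%E.
Proof.
move=> mg g0 c0 Hind f mf f0.
have mfE : measurable_fun setT (fun y => (f y)%:E) by exact/measurable_EFinP.
pose h := nnsfun_approx measurableT mfE.
have mh n : measurable_fun setT (fun w => h n (X w)).
  by apply: measurableT_comp => //.
have h0 n y : 0 <= h n y by exact: fun_ge0.
have Hh n : (\int[P]_w (h n (X w) * g w)%:E = \int[P]_w (h n (X w))%:E * c%:E)%E.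
  have mA y : measurable_fun setT (fun w => \1_(h n @^-1` [set y]) (X w) : R).
    by apply: measurableT_comp => //.
  have fin : finite_set (range (h n)) by exact: fimfunP.
  have y0 w y : 0 <= y * \1_(h n @^-1` [set y]) (X w).
    rewrite indicE; case: (boolP (_ \in _)) => [|_]; last by rewrite mulr0.
    by rewrite inE /= => <-; rewrite mulr1.
  transitivity (\int[P]_w \sum_(y \in range (h n))
     (y * \1_(h n @^-1` [set y]) (X w) * g w)%:E)%E.
    apply: eq_integral => w _; rewrite fsumEFin//; congr EFin.
    by rewrite fimfunE mulrC mulr_fsumr; apply: eq_fsbigr => y _; rewrite mulrC.
  rewrite ge0_integral_fsum//; last 2 first.
  - by move=> y; apply/measurable_EFinP; apply: measurable_funM => //;
      apply: measurable_funM.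
  - by move=> y w _; rewrite lee_fin mulr_ge0.
  transitivity ((\int[P]_w \sum_(y \in range (h n))
     (y * \1_(h n @^-1` [set y]) (X w))%:E)%E * c%:E)%E; last first.
    congr (_ * _)%E; apply: eq_integral => w _; rewrite fsumEFin//; congr EFin.
    by rewrite fimfunE.
  rewrite ge0_integral_fsum//; last 2 first.
  - by move=> y; apply/measurable_EFinP; apply: measurable_funM.
  - by move=> y w _; rewrite lee_fin.
  rewrite ge0_mule_fsuml; last by move=> y; apply: integral_ge0 => w _; rewrite lee_fin.
  apply: eq_fsbigr => y; rewrite inE => -[z _ <-].
  rewrite (_ : (fun w => _) = fun w => ((h n z)%:E *
     (\1_(h n @^-1` [set h n z]) (X w) * g w)%:E)%E); last first.
    by apply/funext => w; rewrite -EFinM mulrA.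
  rewrite ge0_integralZl//; last 3 first.
  - by apply/measurable_EFinP; apply: measurable_funM.
  - by move=> w _; rewrite lee_fin mulr_ge0.
  - by rewrite lee_fin.
  rewrite Hind; last exact: measurable_sfunP.
  rewrite muleA; congr (_ * _)%E.
  rewrite -ge0_integralZl//; last 2 first.
  - by apply/measurable_EFinP.
  - by rewrite lee_fin.
have hf y : (h n y)%:E @[n --> \oo] --> (f y)%:E.
  by apply: (@cvg_nnsfun_approx _ _ _ setT measurableT _ mfE) => // ? _; rewrite lee_fin.
have ndh y : {homo (fun n => h n y) : n m / (n <= m)%N >-> n <= m}.
  by move=> n m nm; apply/lefP: y; exact: nd_nnsfun_approx.
have C1 : (\int[P]_w (h n (X w) * g w)%:E)%E @[n --> \oo] -->
    (\int[P]_w (f (X w) * g w)%:E)%E.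
  rewrite (_ : (\int[P]_w (f (X w) * g w)%:E)%E =
      (\int[P]_w limn (fun n => (h n (X w) * g w)%:E))%E); last first.
    apply: eq_integral => w _; apply/esym/cvg_lim => //.
    apply: (@cvg_trans _ ((h n (X w))%:E * (g w)%:E @[n --> \oo])%E).
      by under eq_fun do rewrite EFinM.
    by rewrite EFinM; apply: cvgeZr => //; exact: hf.
  apply: cvg_monotone_convergence => //.
  - by move=> n; apply/measurable_EFinP; apply: measurable_funM.
  - by move=> n w _; rewrite lee_fin mulr_ge0.
  - by move=> w _ n m nm; rewrite lee_fin ler_wpM2r// ndh.
have C2 : (\int[P]_w (h n (X w))%:E)%E @[n --> \oo] --> (\int[P]_w (f (X w))%:E)%E.
  rewrite (_ : (\int[P]_w (f (X w))%:E)%E =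
      (\int[P]_w limn (fun n => (h n (X w))%:E))%E); last first.
    by apply: eq_integral => w _; apply/esym/cvg_lim => //; exact: hf.
  apply: cvg_monotone_convergence => //.
  - by move=> n; apply/measurable_EFinP.
  - by move=> n w _; rewrite lee_fin.
  - by move=> w _ n m nm; rewrite lee_fin ndh.
apply: (cvg_unique _ C1) => //; rewrite (_ : _ @ \oo =
    (\int[P]_w (h n (X w))%:E * c%:E)%E @[n --> \oo]); last first.
  by congr (_ @ \oo); apply/funext => n; exact: Hh.
exact: cvgeZr.
Qed.

(* Independence is the case of indicators; the factors are promoted to nonnegative
   functions one coordinate at a time. *)
Lemma ge0_integral_prod_independent (I : finType) (e : I -> {RV P >-> R})
    (f : I -> R -> R) : mutually_independent e ->
  (forall i, measurable_fun setT (f i)) -> (forall i y, 0 <= f i y) ->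
  (forall i, P.-integrable setT (fun w => (f i (e i w))%:E)) ->
  (\int[P]_w (\prod_i f i (e i w))%:E)%E =
  (\prod_i \int[P]_w f i (e i w))%:E.
Proof.
move=> ind.
suff main : forall s : seq I, forall f : I -> R -> R,
    (forall i, measurable_fun setT (f i)) -> (forall i y, 0 <= f i y) ->
    (forall i, P.-integrable setT (fun w => (f i (e i w))%:E)) ->
    (forall i, i \notin s -> exists2 A, measurable A & f i = \1_A) ->
    (\int[P]_w (\prod_i f i (e i w))%:E)%E =
    (\prod_i \int[P]_w f i (e i w))%:E.
  by move=> mf f0 If; apply: (main (enum I)) => // i; rewrite mem_enum.
elim=> [|i s IH] {}f mf f0 If indic.
  have /choice[A HA] : forall i, exists A, measurable A /\ f i = \1_A.
    by move=> i; have [A mA fA] := indic i isT; exists A.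
  have mA i : measurable (e i @^-1` A i).
    by rewrite -[X in measurable X]setTI; apply: measurable_funP => //; case: (HA i).
  rewrite (eq_integral (fun w =>
      (\1_(\bigcap_(i in [set` [set: I]%SET]) (e i @^-1` A i)) w)%:E)).
    rewrite integral_indic//; last first.
      by apply: fin_bigcap_measurable.
    rewrite setIT; apply: (etrans (ind [set: I]%SET A _)).
      by move=> i _; case: (HA i).
    rewrite (big_morph _ EFinM erefl); apply: eq_big => [i|i _]; first by rewrite inE.
    rewrite /Rintegral; under eq_integral do rewrite (HA i).2.
    rewrite (_ : integral _ _ _ = (\int[P]_w (\1_(e i @^-1` A i) w)%:E)%E)//.
    by rewrite integral_indic// setIT fineK// fin_num_measure.
  move=> w _; congr EFin; rewrite indicE; case: (boolP (_ \in _)) => /=.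
    rewrite inE => /= H; apply: big1 => i _.
    by rewrite (HA i).2 indicE mem_set//; apply: H => /=; rewrite inE.
  rewrite notin_setE => H.
  have [i Hi] : exists i, ~ A i (e i w).
    by apply: contrapT => H1; apply: H => i _; apply: contrapT => H2; apply: H1; exists i.
  by rewrite (bigD1 i)//= (HA i).2 indicE memNset// mul0r.
pose g w := \prod_(j | j != i) f j (e j w).
pose c := \prod_(j | j != i) \int[P]_w f j (e j w).
transitivity (\int[P]_w (f i (e i w) * g w)%:E)%E.
  by apply: eq_integral => w _; rewrite (bigD1 i).
rewrite (@ge0_integral_comp_weight (e i) g c) => //.
- rewrite [in RHS](bigD1 i)//= EFinM; congr (_ * _)%E.
  by rewrite /Rintegral fineK//; apply: integrable_fin_num.
- rewrite /g; under eq_fun do rewrite -big_filter.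
  by apply: measurable_prod => j _; apply: measurableT_comp.
- by move=> w; apply: prodr_ge0.
- by apply: prodr_ge0 => j _; apply: Rintegral_ge0.
move=> A mA.
have I1 : P.-integrable setT (fun w => (\1_A (e i w))%:E).
  apply: (@eq_integrable _ _ _ P setT _ (EFin \o \1_(e i @^-1` A))) => //.
  apply: integrable_indic => //.
  by rewrite -[X in measurable X]setTI; apply: measurable_funP.
(* With an indicator at [i], the family [f'] is one to which the induction hypothesis for the
   shorter list applies; this is the indicator case required by [ge0_integral_comp_weight]. *)
pose f' j := if j == i then \1_A else f j.
have f'E j : j != i -> f' j = f j by rewrite /f' => /negbTE ->.
have f'i : f' i = \1_A by rewrite /f' eqxx.
have := IH f'; rewrite (bigD1 i)//= f'i.
rewrite (eq_bigr (fun j => \int[P]_w f j (e j w))); last first.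
  by move=> j ji; rewrite f'E.
rewrite EFinM {1}/Rintegral fineK; last by apply: integrable_fin_num.
move=> <-.
- apply: eq_integral => w _; rewrite [in RHS](bigD1 i)//= f'i; congr (_ * _)%:E.
  by apply: eq_bigr => j ji; rewrite f'E.
- by move=> j; have [->|/f'E->//] := eqVneq j i; rewrite f'i.
- by move=> j y; have [->|/f'E->//] := eqVneq j i; rewrite f'i indicE.
- by move=> j; have [->|/f'E->//] := eqVneq j i; rewrite f'i.
- move=> j js; have [->|ji] := eqVneq j i; first by exists A; rewrite ?f'i.
  by rewrite f'E//; apply: indic; rewrite inE negb_or ji.
Qed.

End independence.

(** * Integrable real functions and complex expectations *)

Section expectation.
Context d (T : measurableType d) (R : realType) (P : probability T R).
Implicit Types f g : T -> R.

Definition intble f := P.-integrable setT (EFin \o f).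

Lemma intble_cst (c : R) : intble (fun=> c).
Proof.
by apply: (finite_measure_integrable_cst P c).
Qed.

Lemma intbleD f g : intble f -> intble g -> intble (fun w => f w + g w).
Proof. by move=> hf hg; exact: (integrableD measurableT hf hg). Qed.

Lemma intbleB f g : intble f -> intble g -> intble (fun w => f w - g w).
Proof. by move=> hf hg; exact: (integrableB measurableT hf hg). Qed.

Lemma intbleZ (c : R) f : intble f -> intble (fun w => c * f w).
Proof. by move=> hf; exact: (integrableZl measurableT c hf). Qed.

Lemma intble_norm f : intble f -> intble (fun w => `|f w|).
Proof. by move=> hf; exact: (integrable_abse hf). Qed.

Lemma intble_sum (I : Type) (r : seq I) (Q : pred I) (F : I -> T -> R) :
  (forall i, Q i -> intble (F i)) -> intble (fun w => \sum_(i <- r | Q i) F i w).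
Proof.
move=> hF; elim: r => [|i r IH].
  rewrite (_ : (fun w => _) = fun=> 0); first exact: intble_cst.
  by apply/funext => w; rewrite big_nil.
have [Qi|nQi] := boolP (Q i).
  rewrite (_ : (fun w => _) = fun w => F i w + \sum_(i <- r | Q i) F i w).
    by apply: intbleD IH; apply: hF.
  by apply/funext => w; rewrite big_cons Qi.
rewrite (_ : (fun w => _) = fun w => \sum_(i <- r | Q i) F i w)//.
by apply/funext => w; rewrite big_cons (negbTE nQi).
Qed.

Lemma intble_le f g : measurable_fun setT f -> intble g ->
  (forall w, `|f w| <= `|g w|) -> intble f.
Proof.
move=> mf hg fg; apply: (le_integrable _ _ _ hg) => //.
  exact/measurable_EFinP.
by move=> w _ /=; rewrite lee_fin.
Qed.

Lemma intble_measurable f : intble f -> measurable_fun setT f.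
Proof. by move/measurable_int/measurable_EFinP. Qed.

Lemma Rintegral_sum (I : Type) (r : seq I) (Q : pred I) (F : I -> T -> R) :
  (forall i, Q i -> intble (F i)) ->
  \int[P]_w (\sum_(i <- r | Q i) F i w) = \sum_(i <- r | Q i) \int[P]_w F i w.
Proof.
move=> hF; elim: r => [|i r IH].
  rewrite big_nil (@eq_Rintegral _ _ _ _ _ (fun=> 0)) ?Rintegral_cst ?mul0r//.
  by move=> w _; rewrite big_nil.
rewrite big_cons; have [Qi|nQi] := boolP (Q i); last first.
  by rewrite -IH; apply: eq_Rintegral => w _; rewrite big_cons (negbTE nQi).
rewrite -IH -RintegralD//; [|exact: hF|exact: intble_sum].
by apply: eq_Rintegral => w _; rewrite big_cons Qi.
Qed.

Lemma Rintegral_prob_cst (c : R) : \int[P]_w c = c.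
Proof.
have := probability_setT P => /(congr1 fine) /= P1.
rewrite Rintegral_cst// -[RHS]mulr1; congr (c * _); exact: P1.
Qed.

Local Open Scope complex_scope.
Local Notation Re := (@complex.Re _).
Local Notation Im := (@complex.Im _).

Definition cexpectation (F : T -> R[i]) : R[i] :=
  (\int[P]_w Re (F w)) +i* (\int[P]_w Im (F w)).

Lemma ReD (x y : R[i]) : Re (x + y) = Re x + Re y.
Proof. by case: x y => [a b] [c e]. Qed.
Lemma ImD (x y : R[i]) : Im (x + y) = Im x + Im y.
Proof. by case: x y => [a b] [c e]. Qed.
Lemma ReMr (x : R[i]) (r : R) : Re (x * r%:C) = Re x * r.
Proof. by case: x => [a b] /=; rewrite mulr0 subr0. Qed.
Lemma ImMr (x : R[i]) (r : R) : Im (x * r%:C) = Im x * r.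
Proof. by case: x => [a b] /=; rewrite mulr0 add0r. Qed.

Lemma cexpectation_lin (J : finType) (c : J -> R[i]) (G : J -> T -> R) :
  (forall j, intble (G j)) ->
  cexpectation (fun w => \sum_j c j * (G j w)%:C) =
  \sum_j c j * (\int[P]_w G j w)%:C.
Proof.
move=> hG; rewrite /cexpectation.
have eRe w : Re (\sum_j c j * (G j w)%:C) = \sum_j Re (c j) * G j w.
  by rewrite (big_morph _ ReD erefl); apply: eq_bigr => j _; rewrite ReMr.
have eIm w : Im (\sum_j c j * (G j w)%:C) = \sum_j Im (c j) * G j w.
  by rewrite (big_morph _ ImD erefl); apply: eq_bigr => j _; rewrite ImMr.
under eq_Rintegral do rewrite eRe.
under [X in _ +i* X]eq_Rintegral do rewrite eIm.
rewrite !Rintegral_sum//; try by move=> j _; apply: intbleZ.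
apply/eqP; rewrite eq_complex /= (big_morph _ ReD erefl) (big_morph _ ImD erefl).
apply/andP; split; apply/eqP; apply: eq_bigr => j _.
  by rewrite ReMr RintegralZl//; exact: hG.
by rewrite ImMr RintegralZl//; exact: hG.
Qed.

Definition posneg (b : bool) (y : R) : R := Num.max (if b then y else - y) 0.

Lemma posneg_ge0 b y : 0 <= posneg b y.
Proof. by rewrite /posneg le_max lexx orbT. Qed.

Lemma posnegE y : y = posneg true y - posneg false y.
Proof.
rewrite /posneg /=; have [y0|y0] := leP 0 y.
  by rewrite max_r ?subr0// oppr_le0.
by rewrite max_l ?sub0r ?opprK// oppr_ge0 ltW.
Qed.

Lemma posneg_le b y : `|posneg b y| <= `|y|.
Proof.
rewrite ger0_norm ?posneg_ge0// /posneg ge_max normr_ge0 andbT.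
by case: b; [|rewrite -normrN]; apply: ler_norm.
Qed.

Lemma measurable_posneg b : measurable_fun setT (posneg b).
Proof.
apply: measurable_maxr => //; case: b => //.
exact: oppr_measurable.
Qed.

Definition cunit (k : bool * bool) : R[i] :=
  match k with
  | (true, true) => 1 | (true, false) => - 1
  | (false, true) => 0 +i* 1 | (false, false) => 0 +i* (- 1) end.

Definition cpart (k : bool * bool) (z : R[i]) : R :=
  posneg k.2 (if k.1 then Re z else Im z).

Lemma cpartE (z : R[i]) : z = \sum_k cunit k * (cpart k z)%:C.
Proof.
rewrite (eq_bigr (fun p => cunit (p.1, p.2) * (cpart (p.1, p.2) z)%:C));
  last by case.
rewrite -(pair_bigA _ (fun a b => cunit (a, b) * (cpart (a, b) z)%:C)) /=.
rewrite !big_bool /cpart /=; case: z => a b /=.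
apply/eqP; rewrite eq_complex /=.
have := posnegE a; have := posnegE b; set A := posneg _ a; set A' := posneg _ a.
set B := posneg _ b; set B' := posneg _ b => -> ->.
by apply/andP; split; apply/eqP; ring.
Qed.

(* Each factor is a combination of four nonnegative parts with coefficients
   1, -1, i, -i; the product of these sums is expanded. *)
Lemma cexpectation_prod (I : finType) (e : I -> {RV P >-> R})
    (F : I -> R -> R[i]) : mutually_independent e ->
  (forall i, measurable_fun setT (fun y => Re (F i y))) ->
  (forall i, measurable_fun setT (fun y => Im (F i y))) ->
  (forall i, intble (fun w => Re (F i (e i w)))) ->
  (forall i, intble (fun w => Im (F i (e i w)))) ->
  cexpectation (fun w => \prod_i F i (e i w)) =
  \prod_i cexpectation (fun w => F i (e i w)).
Proof.
move=> ind mR mI iR iI.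
have mc i k : measurable_fun setT (fun y => cpart k (F i y)).
  case: k => [[] b]; rewrite /cpart /=.
    exact: (measurableT_comp (measurable_posneg b) (mR i)).
  exact: (measurableT_comp (measurable_posneg b) (mI i)).
have ic i k : intble (fun w => cpart k (F i (e i w))).
  case: k => [a b]; apply: (@intble_le _
     (fun w => if a then Re (F i (e i w)) else Im (F i (e i w)))).
  - exact: (measurableT_comp (mc i (a, b))).
  - by case: a.
  - by move=> w; apply: posneg_le.
transitivity (cexpectation (fun w => \sum_(h : {ffun I -> bool * bool})
   (\prod_i cunit (h i)) * (\prod_i cpart (h i) (F i (e i w)))%:C)).
  congr cexpectation; apply/funext => w.
  under eq_bigr do rewrite (cpartE (F _ _)).
  rewrite bigA_distr_bigA; apply: eq_bigr => h _.
  by rewrite big_split /= rmorph_prod.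
have key (h : {ffun I -> bool * bool}) := ge0_integral_prod_independent
   (f := fun i y => cpart (h i) (F i y)) ind (fun i => mc i (h i))
   (fun i y => posneg_ge0 _ _) (fun i => ic i (h i)).
rewrite cexpectation_lin; last first.
  move=> h; apply/integrableP; split.
    apply/measurable_EFinP; apply: measurable_prod => i _.
    exact: (measurableT_comp (mc i (h i))).
  under eq_integral.
    move=> w _; rewrite /= ger0_norm; last first.
      by apply: prodr_ge0 => i _; apply: posneg_ge0.
    over.
  by rewrite key ltry.
transitivity (\prod_i \sum_k cunit k * (\int[P]_w cpart k (F i (e i w)))%:C).
  rewrite bigA_distr_bigA; apply: eq_bigr => h _.
  by rewrite big_split /= -rmorph_prod; congr (_ * _%:C); rewrite {1}/Rintegral key.
apply: eq_bigr => i _.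
by rewrite -cexpectation_lin//; congr cexpectation; apply/funext => w; rewrite -cpartE.
Qed.

End expectation.

(** * Elementary inequalities *)

Section pointwise_derivatives.
Context (R : realType).
Implicit Types (f g : R -> R) (x a b c : R).

Lemma isd_cst c x : is_derive x 1 (fun _ : R => c) 0.
Proof. exact: is_derive_cst. Qed.

Lemma isd_id x : is_derive x 1 (fun y : R => y) 1.
Proof. exact: is_derive_id. Qed.

Lemma isdD f g x a b : is_derive x 1 f a -> is_derive x 1 g b ->
  is_derive x 1 (fun y => f y + g y) (a + b).
Proof. by move=> ? ?; exact: is_deriveD. Qed.

Lemma isdN f x a : is_derive x 1 f a -> is_derive x 1 (fun y => - f y) (- a).
Proof. by move=> ?; exact: is_deriveN. Qed.

Lemma isdM f g x a b : is_derive x 1 f a -> is_derive x 1 g b ->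
  is_derive x 1 (fun y => f y * g y) (f x * b + g x * a).
Proof. by move=> ? ?; exact: is_deriveM. Qed.

Lemma isdX f n x a : is_derive x 1 f a ->
  is_derive x 1 (fun y => f y ^+ n) (n%:R * f x ^+ n.-1 * a).
Proof.
move=> fa; rewrite (_ : (fun y => f y ^+ n) = f ^+ n); first exact: is_deriveX.
by apply/funext => y; rewrite exprfctE.
Qed.

Lemma isd_comp f g x a b : is_derive (f x) 1 g b -> is_derive x 1 f a ->
  is_derive x 1 (fun y => g (f y)) (b * a).
Proof. by move=> ? ?; exact: (@is_derive1_comp _ g f). Qed.

Lemma isd_sin f x a : is_derive x 1 f a ->
  is_derive x 1 (fun y => sin (f y)) (cos (f x) * a).
Proof. by move=> fa; apply: isd_comp. Qed.

Lemma isd_cos f x a : is_derive x 1 f a ->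
  is_derive x 1 (fun y => cos (f y)) (- sin (f x) * a).
Proof. by move=> fa; apply: isd_comp. Qed.

Lemma isd_expR f x a : is_derive x 1 f a ->
  is_derive x 1 (fun y => expR (f y)) (expR (f x) * a).
Proof. by move=> fa; apply: isd_comp. Qed.

End pointwise_derivatives.

(** The derivative is built from the syntax of the function as a unification variable; what remains
    is an equation between its value and the announced one, for [ring] or [field]. *)
Ltac isd := eapply is_derive_eq; [repeat first [eapply isd_cst | eapply isd_id |
  eapply isdN | eapply isdD | eapply isdM | eapply isdX | eapply isd_sin |
  eapply isd_cos | eapply isd_expR] | rewrite /=].

Section taylor.
Context (R : realType).
Implicit Types (f g : R -> R) (a b x y : R).

Lemma is_derive_le f f' g g' a b : a <= b ->
  (forall x, a < x < b -> is_derive x 1 f (f' x)) ->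
  (forall x, a < x < b -> is_derive x 1 g (g' x)) ->
  {within `[a, b], continuous f} -> {within `[a, b], continuous g} ->
  (forall x, a < x < b -> f' x <= g' x) -> f a <= g a -> f b <= g b.
Proof.
move=> ab df dg cf cg dfg fga; rewrite -subr_ge0.
have h x : a < x < b -> is_derive x 1 (g - f) (g' x - f' x).
  by move=> axb; have := df _ axb; have := dg _ axb => ? ?; exact: is_deriveB.
apply: (@le_trans _ _ ((g - f) a)); first by rewrite subr_ge0.
apply: (@ger0_derive1_ndecr _ _ a b) => // x.
- by rewrite in_itv/= => axb; have := h _ axb => ?; exact: ex_derive.
- rewrite in_itv/= => axb; have := h _ axb => ?.
  by rewrite derive1E derive_val subr_ge0 dfg.
- exact: within_continuousB.
Qed.

(** Plays the role of integration from 0: a bound on derivatives becomes a bound one degree higher.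
    The Taylor estimates below are obtained in this way from sin <= 1, cos <= 1 and exp u >= 1 +
    u. *)
Lemma is_derive_le0 f f' g g' y : 0 <= y ->
  (forall x, is_derive x 1 f (f' x)) -> (forall x, is_derive x 1 g (g' x)) ->
  (forall x, 0 <= x -> f' x <= g' x) -> f 0 <= g 0 -> f y <= g y.
Proof.
move=> y0 df dg dfg; apply: (@is_derive_le f f' g g' 0 y) => // [||x /andP[x0 _]].
- by apply: derivable_within_continuous => x _; have := df x => ?; exact: ex_derive.
- by apply: derivable_within_continuous => x _; have := dg x => ?; exact: ex_derive.
- by apply: dfg; exact: ltW.
Qed.

Lemma sin_le_id y : 0 <= y -> sin y <= y.
Proof.
move=> y0; apply: (@is_derive_le0 sin cos id (fun=> 1) y) => //.
by rewrite sin0.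
Qed.

Lemma cos_ge1Bsqr y : 0 <= y -> 1 - y ^+ 2 / 2 <= cos y.
Proof.
move=> y0; apply: (@is_derive_le0 (fun x => 1 - x ^+ 2 / 2) (fun x => - x) cos (fun x => - sin x) y) => //.
- by move=> x; isd; field.
- by move=> x x0; rewrite lerN2 sin_le_id.
- by rewrite cos0 expr0n /= mul0r subr0.
Qed.

Lemma sin_ge_cube y : 0 <= y -> y - y ^+ 3 / 6 <= sin y.
Proof.
move=> y0; apply: (@is_derive_le0 (fun x => x - x ^+ 3 / 6) (fun x => 1 - x ^+ 2 / 2) sin cos y) => //.
- by move=> x; isd; field.
- exact: cos_ge1Bsqr.
- by rewrite sin0 expr0n /= mul0r subr0.
Qed.

Lemma cos_ge1B y : 0 <= y -> 1 - y <= cos y.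
Proof.
move=> y0; apply: (@is_derive_le0 (fun x => 1 - x) (fun x => - 1) cos (fun x => - sin x) y) => //.
- by move=> x; isd; ring.
- by move=> x _; rewrite lerN2 sin_le1.
- by rewrite cos0 subr0.
Qed.

Lemma sin_ge_sqr y : 0 <= y -> y - y ^+ 2 / 2 <= sin y.
Proof.
move=> y0; apply: (@is_derive_le0 (fun x => x - x ^+ 2 / 2) (fun x => 1 - x) sin cos y) => //.
- by move=> x; isd; field.
- exact: cos_ge1B.
- by rewrite sin0 expr0n /= mul0r subr0.
Qed.

Lemma cos_le_cube y : 0 <= y -> cos y <= 1 - y ^+ 2 / 2 + y ^+ 3 / 6.
Proof.
move=> y0; apply: (@is_derive_le0 cos (fun x => - sin x) (fun x => 1 - x ^+ 2 / 2 + x ^+ 3 / 6) (fun x => - (x - x ^+ 2 / 2)) y) => //.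
- by move=> x; isd; field.
- by move=> x x0; rewrite lerN2 sin_ge_sqr.
- by rewrite cos0 !expr0n /=; lra.
Qed.

Lemma expRN_le_quadratic y : 0 <= y -> expR (- y) <= 1 - y + y ^+ 2 / 2.
Proof.
move=> y0; apply: (@is_derive_le0 (fun x => expR (- x)) (fun x => - expR (- x)) (fun x => 1 - x + x ^+ 2 / 2) (fun x => - (1 - x)) y) => //.
- by move=> x; isd; ring.
- by move=> x; isd; field.
- by move=> x _; rewrite lerN2; have := expR_ge1Dx (- x).
- by rewrite oppr0 expR0 expr0n /=; lra.
Qed.

Lemma abs_sin_le y : `|sin y| <= `|y|.
Proof.
wlog y0 : y / 0 <= y => [H|].
  have [/H//|y0] := leP 0 y; rewrite -normrN -sinN -[`|y|]normrN H// oppr_ge0 ltW//.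
have h1 := sin_le_id y0; have h2 := sin_geN1 y; have h3 := sin_ge_sqr y0.
rewrite (ger0_norm y0) ler_norml h1 andbT; nra.
Qed.

(** Both orders serve to produce exactly |X|^3 when y = u X: the cube in E[sin(u X)], the square in
    E[X sin(u X)], where one factor X is already present. *)
Lemma abs_sinB_le y : `|sin y - y| <= y ^+ 2 /\ `|sin y - y| <= `|y| ^+ 3.
Proof.
wlog y0 : y / 0 <= y => [H|].
  have [/H//|y0] := leP 0 y; have := H (- y).
  by rewrite sinN -opprD !normrN sqrrN; apply; rewrite oppr_ge0 ltW.
have h1 := sin_le_id y0; have h2 := sin_ge_cube y0; have h3 := sin_ge_sqr y0.
have y3 : 0 <= y ^+ 3 by exact: exprn_ge0.
by rewrite (ger0_norm y0) ler0_norm ?subr_le0//; split; nra.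
Qed.

Lemma abs_cosB1_le y : `|cos y - 1| <= y ^+ 2 /\ `|cos y - 1| <= `|y|.
Proof.
wlog y0 : y / 0 <= y => [H|].
  have [/H//|y0] := leP 0 y; have := H (- y).
  by rewrite cosN normrN sqrrN; apply; rewrite oppr_ge0 ltW.
have h1 := cos_le1 y; have h2 := cos_ge1Bsqr y0; have h3 := cos_ge1B y0.
by rewrite (ger0_norm y0) ler0_norm ?subr_le0//; split; nra.
Qed.

Lemma abs_cos_quadratic_le y : `|cos y - (1 - y ^+ 2 / 2)| <= `|y| ^+ 3.
Proof.
wlog y0 : y / 0 <= y => [H|].
  have [/H//|y0] := leP 0 y; have := H (- y).
  by rewrite cosN normrN sqrrN; apply; rewrite oppr_ge0 ltW.
have h1 := cos_ge1Bsqr y0; have h2 := cos_le_cube y0.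
have y3 : 0 <= y ^+ 3 by exact: exprn_ge0.
by rewrite (ger0_norm y0) ger0_norm ?subr_ge0//; nra.
Qed.

Lemma abs_expRN_linear_le (u : R) : `|expR (- (u ^+ 2 / 2)) - (1 - u ^+ 2 / 2)| <= `|u| ^+ 3.
Proof.
have v0 : 0 <= u ^+ 2 / 2 by rewrite divr_ge0// sqr_ge0.
have h1 := expR_ge1Dx (- (u ^+ 2 / 2)); have h2 := expRN_le_quadratic v0.
have h3 : expR (- (u ^+ 2 / 2)) <= 1 by rewrite expR_le1 oppr_le0.
rewrite ger0_norm; last by lra.
have a0 := normr_ge0 u.
move: h1 h2 h3; rewrite -[u ^+ 2]real_normK ?num_real//.
set a := `|u| in a0 *; set E := expR _ => h1 h2 h3.
have a3 : 0 <= a ^+ 3 by exact: exprn_ge0.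
(* For a <= 1 the second-order remainder a^4 / 8 is below a^3; for a > 1 the bound exp <= 1 leaves
   only a^2 / 2. *)
have [a1|a1] := leP a 1.
  suff : (a ^+ 2 / 2) ^+ 2 / 2 <= a ^+ 3 by lra.
  rewrite (_ : (a ^+ 2 / 2) ^+ 2 / 2 = a ^+ 3 * (a / 8)); last by field.
  by rewrite ler_piMr//; lra.
suff : a ^+ 2 / 2 <= a ^+ 3 by lra.
have -> : a ^+ 3 = a ^+ 2 * a by ring.
have : 0 <= a ^+ 2 by exact: exprn_ge0.
nra.
Qed.
End taylor.

Lemma add1_cube_le (F : realFieldType) (y : F) : 1 <= y -> (y + 1) ^+ 3 <= 8 * y ^+ 4.
Proof.
move=> y1; have y0 : 0 <= y := le_trans ler01 y1.
apply: (@le_trans _ _ ((2 * y) ^+ 3)).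
  by apply: lerXn2r; rewrite ?nnegrE; lra.
rewrite (_ : (2 * y) ^+ 3 = 8 * y ^+ 3); last by ring.
by rewrite ler_pM2l// ler_weXn2l.
Qed.

(** * Characteristic functions *)

Section third_moment.
Context d (T : measurableType d) (R : realType) (P : probability T R).
Implicit Types f g h X : T -> R.

Lemma measurable_cos_comp f :
  measurable_fun setT f -> measurable_fun setT (fun w => cos (f w)).
Proof.
apply: measurableT_comp; apply: continuous_measurable_fun.
exact: continuous_cos.
Qed.

Lemma measurable_sin_comp f :
  measurable_fun setT f -> measurable_fun setT (fun w => sin (f w)).
Proof.
apply: measurableT_comp; apply: continuous_measurable_fun.
exact: continuous_sin.
Qed.

Lemma Rintegral_dist_le f g h : intble P f -> intble P g -> intble P h ->
  (forall w, `|f w - g w| <= h w) ->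
  `|\int[P]_w f w - \int[P]_w g w| <= \int[P]_w h w.
Proof.
move=> If Ig Ih fgh; rewrite -RintegralB//.
apply: (le_trans (le_normr_Rintegral _ _)) => //; first exact: intbleB.
by apply: le_Rintegral => //; exact/intble_norm/intbleB.
Qed.

Lemma Rintegral_norm_le f h : intble P f -> intble P h ->
  (forall w, `|f w| <= h w) -> `|\int[P]_w f w| <= \int[P]_w h w.
Proof.
move=> If Ih fh; apply: (le_trans (le_normr_Rintegral _ _)) => //.
by apply: le_Rintegral => //; exact: intble_norm.
Qed.

Lemma intble_bounded f (c : R) : measurable_fun setT f ->
  (forall w, `|f w| <= c) -> intble P f.
Proof.
move=> mf fc; apply: (@intble_le _ _ _ _ _ (fun=> c)) => //; first exact: intble_cst.
by move=> w; apply: (le_trans (fc w)); exact: ler_norm.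
Qed.

Lemma intble_cos f : measurable_fun setT f -> intble P (fun w => cos (f w)).
Proof.
by move=> mf; apply: (@intble_bounded _ 1); [exact: measurable_cos_comp|move=> w; exact: cos_max].
Qed.

Lemma intble_sin f : measurable_fun setT f -> intble P (fun w => sin (f w)).
Proof.
by move=> mf; apply: (@intble_bounded _ 1); [exact: measurable_sin_comp|move=> w; exact: sin_max].
Qed.

Lemma intbleMb f g (c : R) : intble P f -> measurable_fun setT g ->
  (forall w, `|g w| <= c) -> intble P (fun w => f w * g w).
Proof.
move=> If mg gc; apply: (@intble_le _ _ _ _ _ (fun w => c * f w)).
- by apply: measurable_funM => //; exact: intble_measurable If.
- exact: intbleZ.
- move=> w; rewrite !normrM mulrC ler_wpM2r//.
  by apply: (le_trans (gc w)); exact: ler_norm.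
Qed.

Lemma intbleM_cos f g : intble P f -> measurable_fun setT g ->
  intble P (fun w => f w * cos (g w)).
Proof.
move=> If mg; apply: (@intbleMb _ _ 1) => //; first exact: measurable_cos_comp.
by move=> w; exact: cos_max.
Qed.

Lemma intbleM_sin f g : intble P f -> measurable_fun setT g ->
  intble P (fun w => f w * sin (g w)).
Proof.
move=> If mg; apply: (@intbleMb _ _ 1) => //; first exact: measurable_sin_comp.
by move=> w; exact: sin_max.
Qed.

(** The sub-Gaussian bound K enters the analytic estimates only through the bound [rho] on the third
    moment. *)
Record standard_moments X (rho : R) : Prop := StandardMoments {
  sm_measurable : measurable_fun setT X;
  sm_int3 : intble P (fun w => `|X w| ^+ 3);
  sm_mean : \int[P]_w X w = 0;
  sm_var : \int[P]_w (X w ^+ 2) = 1;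
  sm_third : \int[P]_w (`|X w| ^+ 3) <= rho }.

Variables (X : T -> R) (rho : R).
Hypothesis HX : standard_moments X rho.

Let mX : measurable_fun setT X := sm_measurable HX.

Lemma sm_int2 : intble P (fun w => X w ^+ 2).
Proof.
apply: (@intble_le _ _ _ _ _ (fun w => 1 + `|X w| ^+ 3)).
- exact: measurable_funX.
- by apply: intbleD; [exact: intble_cst|exact: sm_int3 HX].
- move=> w; rewrite -[X w ^+ 2]real_normK ?num_real//.
  have := normr_ge0 (X w); set a := `|X w| => a0.
  have a3 : 0 <= a ^+ 3 by exact: exprn_ge0.
  rewrite !ger0_norm ?addr_ge0 ?exprn_ge0//; nra.
Qed.

Lemma sm_int1 : intble P X.
Proof.
apply: (@intble_le _ _ _ _ _ (fun w => 1 + X w ^+ 2)) => //.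
- by apply: intbleD; [exact: intble_cst|exact: sm_int2].
- move=> w; rewrite -[X w ^+ 2]real_normK ?num_real//.
  have := normr_ge0 (X w); set a := `|X w| => a0.
  rewrite ger0_norm ?addr_ge0 ?exprn_ge0//; nra.
Qed.

Lemma int3_scale c : 0 <= c -> \int[P]_w (c * `|X w| ^+ 3) <= rho * c.
Proof.
move=> c0; rewrite RintegralZl//; last exact: (sm_int3 HX).
by rewrite mulrC ler_wpM2r// (sm_third HX).
Qed.

Lemma int2_scale c : \int[P]_w (c * X w ^+ 2) = c.
Proof.
by rewrite RintegralZl//; [rewrite (sm_var HX) mulr1|exact: sm_int2].
Qed.

Let mu u : measurable_fun setT (fun w => u * X w).
Proof. exact: measurable_funM. Qed.

Lemma int_cos_approx u :
  `|\int[P]_w cos (u * X w) - (1 - u ^+ 2 / 2)| <= rho * `|u| ^+ 3.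
Proof.
have -> : 1 - u ^+ 2 / 2 = \int[P]_w (1 + - (u ^+ 2 / 2) * X w ^+ 2).
  rewrite RintegralD//; last 2 first.
  - exact: intble_cst.
  - by apply: intbleZ; exact: sm_int2.
  rewrite RintegralZl//; last exact: sm_int2.
  by rewrite (sm_var HX) Rintegral_prob_cst mulr1.
apply: (le_trans (Rintegral_dist_le _ _ (intbleZ (`|u| ^+ 3) (sm_int3 HX)) _)).
- exact: intble_cos.
- by apply: intbleD; [exact: intble_cst|apply: intbleZ; exact: sm_int2].
- move=> w; rewrite -exprMn -normrM.
  have := abs_cos_quadratic_le (u * X w).
  by congr (`|_ - _| <= _); rewrite exprMn mulNr mulrAC.
by apply: int3_scale; rewrite ?sqr_ge0 ?exprn_ge0.
Qed.

Lemma int_sin_small u : `|\int[P]_w sin (u * X w)| <= rho * `|u| ^+ 3.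
Proof.
have -> : \int[P]_w sin (u * X w) = \int[P]_w sin (u * X w) - \int[P]_w (u * X w).
  by rewrite RintegralZl//; [rewrite (sm_mean HX) mulr0 subr0|exact: sm_int1].
apply: (le_trans (Rintegral_dist_le _ _ (intbleZ (`|u| ^+ 3) (sm_int3 HX)) _)).
- exact: intble_sin.
- by apply: intbleZ; exact: sm_int1.
- by move=> w; rewrite -exprMn -normrM; exact: (abs_sinB_le (u * X w)).2.
by apply: int3_scale; rewrite ?sqr_ge0 ?exprn_ge0.
Qed.

Lemma int_Mcos_small u :
  `|\int[P]_w (X w * cos (u * X w))| <= rho * u ^+ 2 /\
  `|\int[P]_w (X w * cos (u * X w))| <= `|u|.
Proof.
have Ic : intble P (fun w => X w * cos (u * X w)).
  by apply: intbleM_cos => //; exact: sm_int1.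
have -> : \int[P]_w (X w * cos (u * X w)) =
   \int[P]_w (X w * cos (u * X w)) - \int[P]_w X w by rewrite (sm_mean HX) subr0.
split.
  apply: (le_trans (Rintegral_dist_le Ic sm_int1 (intbleZ (u ^+ 2) (sm_int3 HX)) _)).
    move=> w; rewrite -{3}[X w]mulr1 -mulrBr normrM.
    have := (abs_cosB1_le (u * X w)).1; rewrite exprMn.
    rewrite -[X in _ <= _ * X -> _]real_normK ?num_real// => h.
    apply: (le_trans (ler_wpM2l (normr_ge0 _) h)).
    by rewrite le_eqVlt; apply/orP; left; apply/eqP; ring.
  by apply: int3_scale; rewrite ?sqr_ge0 ?exprn_ge0.
apply: (le_trans (Rintegral_dist_le Ic sm_int1 (intbleZ `|u| sm_int2) _)).
  move=> w; rewrite -{3}[X w]mulr1 -mulrBr normrM.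
  have := (abs_cosB1_le (u * X w)).2; rewrite normrM => h.
  apply: (le_trans (ler_wpM2l (normr_ge0 _) h)).
  by rewrite -[X w ^+ 2]real_normK ?num_real// le_eqVlt; apply/orP; left; apply/eqP; ring.
by rewrite int2_scale.
Qed.

Lemma int_Msin_approx u :
  `|\int[P]_w (X w * sin (u * X w)) - u| <= rho * u ^+ 2 /\
  `|\int[P]_w (X w * sin (u * X w))| <= `|u|.
Proof.
have Ic : intble P (fun w => X w * sin (u * X w)).
  by apply: intbleM_sin => //; exact: sm_int1.
split.
  have {2}<- : \int[P]_w (u * X w ^+ 2) = u.
    by rewrite int2_scale.
  apply: (le_trans (Rintegral_dist_le Ic (intbleZ u sm_int2) (intbleZ (u ^+ 2) (sm_int3 HX)) _)).
    move=> w; rewrite (_ : u * X w ^+ 2 = X w * (u * X w)); last by ring.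
    rewrite -mulrBr normrM.
    have := (abs_sinB_le (u * X w)).1; rewrite exprMn.
    rewrite -[X in _ <= _ * X -> _]real_normK ?num_real// => h.
    apply: (le_trans (ler_wpM2l (normr_ge0 _) h)).
    by rewrite le_eqVlt; apply/orP; left; apply/eqP; ring.
  by apply: int3_scale; rewrite ?sqr_ge0 ?exprn_ge0.
apply: (le_trans (Rintegral_norm_le Ic (intbleZ `|u| sm_int2) _)).
  move=> w; rewrite normrM; have := abs_sin_le (u * X w); rewrite normrM => h.
  apply: (le_trans (ler_wpM2l (normr_ge0 _) h)).
  by rewrite -[X w ^+ 2]real_normK ?num_real// le_eqVlt; apply/orP; left; apply/eqP; ring.
by rewrite int2_scale.
Qed.

End third_moment.

Section characteristic_function.
Context d (T : measurableType d) (R : realType) (P : probability T R).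
Local Open Scope complex_scope.
Local Notation Re := (@complex.Re _).
Local Notation Im := (@complex.Im _).
Local Notation normc := (@Normc.normc _).

Lemma normc_ge_ReIm (z : R[i]) : (`|Re z| <= normc z) * (`|Im z| <= normc z).
Proof.
case: z => a b /=.
by rewrite -!sqrtr_sqr !ler_sqrt ?addr_ge0 ?sqr_ge0// lerDl lerDr !sqr_ge0.
Qed.

Lemma normc_le_ReIm (z : R[i]) : normc z <= `|Re z| + `|Im z|.
Proof.
case: z => a b /=; rewrite -[leRHS]ger0_norm ?addr_ge0// -sqrtr_sqr.
rewrite ler_sqrt ?sqr_ge0// -[a ^+ 2]real_normK ?num_real// -[b ^+ 2]real_normK ?num_real//.
have := normr_ge0 a; have := normr_ge0 b; nra.
Qed.

Lemma normc_ge0 (z : R[i]) : 0 <= normc z.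
Proof. by case: z => a b /=; exact: sqrtr_ge0. Qed.

Lemma normc_prod (I : Type) (r : seq I) (Q : pred I) (F : I -> R[i]) :
  normc (\prod_(i <- r | Q i) F i) = \prod_(i <- r | Q i) normc (F i).
Proof. by apply: (big_morph _ (@Normc.normcM R)); exact: Normc.normc1. Qed.

Lemma normc_real (r : R) : normc r%:C = `|r|.
Proof. by rewrite /= expr0n /= addr0 sqrtr_sqr. Qed.

Definition cis (t : R) : R[i] := cos t +i* sin t.

Lemma cisD s t : cis (s + t) = cis s * cis t.
Proof.
apply/eqP; rewrite eq_complex /= cosD sinD.
by apply/andP; split; apply/eqP; ring.
Qed.

Lemma cis_sum (I : Type) (r : seq I) (Q : pred I) (f : I -> R) :
  cis (\sum_(i <- r | Q i) f i) = \prod_(i <- r | Q i) cis (f i).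
Proof. by apply: (big_morph cis cisD); rewrite /cis cos0 sin0. Qed.

Definition charf (X : T -> R) (u : R) : R[i] :=
  cexpectation P (fun w => cis (u * X w)).

(** The value c + i s of the characteristic function is projected on its own direction: c^2 + s^2 =
    E[c cos(u X) + s sin(u X)], and the integrand is at most (c^2 + s^2 + 1) / 2 pointwise. *)
Lemma charf_norm_le1 (X : T -> R) u : measurable_fun setT X -> normc (charf X u) <= 1.
Proof.
move=> mX; rewrite /charf /cexpectation /=.
have mu : measurable_fun setT (fun w => u * X w) by exact: measurable_funM.
set c := \int[P]_w _; set s := \int[P]_w _.
have : c ^+ 2 + s ^+ 2 <= (c ^+ 2 + s ^+ 2 + 1) / 2.
  have {1}-> : c ^+ 2 + s ^+ 2 = \int[P]_w (c * cos (u * X w) + s * sin (u * X w)).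
    rewrite RintegralD//; last 2 first.
    - by apply: intbleZ; exact: intble_cos.
    - by apply: intbleZ; exact: intble_sin.
    by rewrite !RintegralZl//; [exact: intble_sin|exact: intble_cos].
  rewrite -[leRHS](Rintegral_prob_cst P); apply: le_Rintegral => //.
  - by apply: intbleD; apply: intbleZ; [exact: intble_cos|exact: intble_sin].
  - exact: intble_cst.
  move=> w _ /=; have := cos2Dsin2 (u * X w).
  set C := cos _; set S := sin _ => h.
  have := sqr_ge0 (c - C); have := sqr_ge0 (s - S); nra.
move=> h; rewrite -[leRHS]sqrtr1 ler_sqrt//; lra.
Qed.

(** A common majorant of the characteristic function and of the Gaussian one, as the exchange of
    factors in [normc_prodB_le] requires. Being an exponential, it turns products over coordinates
    into sums of x_i^2 and |x_i|^3. *)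
Definition damp (rho u : R) : R := expR (- (u ^+ 2 / 4) + 2 * rho * `|u| ^+ 3).

(* Valid for all u: when the exponent of damp is nonnegative, |charf| <= 1 suffices. *)
Lemma charf_norm_damp X rho u : standard_moments P X rho -> 1 <= rho ->
  normc (charf X u) <= damp rho u.
Proof.
move=> HX rho1; have [hu|hu] := leP (1 / 4) (rho * `|u|).
  apply: (le_trans (charf_norm_le1 _ (sm_measurable HX))).
  rewrite -[leLHS]expR0 ler_expR -[u ^+ 2]real_normK ?num_real//.
  have := normr_ge0 u; set a := `|u| in hu * => a0.
  have -> : - (a ^+ 2 / 4) + 2 * rho * a ^+ 3 = a ^+ 2 * (2 * (rho * a) - 1 / 4) by field.
  by apply: mulr_ge0; [exact: sqr_ge0|lra].
have h1 := int_cos_approx HX u; have h2 := int_sin_small HX u.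
apply: (le_trans (normc_le_ReIm _)); rewrite /charf /cexpectation /=.
set c := \int[P]_w _ in h1 *; set s := \int[P]_w _ in h2 *.
apply: (@le_trans _ _ (1 - u ^+ 2 / 2 + 2 * (rho * `|u| ^+ 3))).
  move: h1 h2; rewrite -[u ^+ 2]real_normK ?num_real//.
  have := normr_ge0 u; set a := `|u| in hu * => a0 h1 h2.
  have a1 : a <= 1 / 4 by nra.
  have : `|c| <= 1 - a ^+ 2 / 2 + rho * a ^+ 3.
    rewrite -(subrK (1 - a ^+ 2 / 2) c); apply: (le_trans (ler_normD _ _)).
    rewrite addrC [`|1 - _|]ger0_norm ?lerD2l//; nra.
  lra.
apply: (@le_trans _ _ (expR (- (u ^+ 2 / 2) + 2 * (rho * `|u| ^+ 3)))).
  by have := expR_ge1Dx (- (u ^+ 2 / 2) + 2 * (rho * `|u| ^+ 3)); rewrite addrA.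
by rewrite ler_expR mulrA lerD2r lerN2; have := sqr_ge0 u; lra.
Qed.

Lemma gauss_le_damp rho u : 0 <= rho -> expR (- (u ^+ 2 / 2)) <= damp rho u.
Proof.
move=> r0; rewrite ler_expR.
have : 0 <= 2 * rho * `|u| ^+ 3 by rewrite !mulr_ge0 ?exprn_ge0.
have := sqr_ge0 u; lra.
Qed.

Lemma charf_gauss X rho u : standard_moments P X rho -> 1 <= rho ->
  normc (charf X u - (expR (- (u ^+ 2 / 2)))%:C) <= 3 * rho * `|u| ^+ 3.
Proof.
move=> HX rho1; have h1 := int_cos_approx HX u; have h2 := int_sin_small HX u.
apply: (le_trans (normc_le_ReIm _)); rewrite /charf /cexpectation /= subr0.
set c := \int[P]_w _ in h1 *; set s := \int[P]_w _ in h2 *.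
have h3 := abs_expRN_linear_le u; set E := expR _ in h3 *.
have : `|c - E| <= rho * `|u| ^+ 3 + `|u| ^+ 3.
  rewrite -(subrK (1 - u ^+ 2 / 2) c) -addrA; apply: (le_trans (ler_normD _ _)).
  by apply: lerD => //; rewrite distrC.
have : `|u| ^+ 3 <= rho * `|u| ^+ 3 by rewrite ler_peMl ?exprn_ge0.
lra.
Qed.

End characteristic_function.

(** * Trigonometric approximation of the quantization error *)

Section smooth_cutoff.
Context (R : realType).
Implicit Types (A : R -> R) (d : R).

(** For even [A] this is the sum of A(k) e^(i k d) over |k| <= n. Coefficients are functions on the
    reals so that differences at 0 and beyond n make sense and are polynomial identities. *)
Definition cos_poly A n d : R := A 0 + 2 * \sum_(k < n) A k.+1%:R * cos (k.+1%:R * d).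

Definition diff2 A (t : R) : R := 2 * A t - A (t + 1) - A (t - 1).

Lemma cos_addn2 n d : cos (n.+2%:R * d) = 2 * cos d * cos (n.+1%:R * d) - cos (n%:R * d).
Proof.
have -> : n.+2%:R * d = n.+1%:R * d + d by rewrite -[n.+2]addn1 natrD; ring.
have -> : n%:R * d = n.+1%:R * d - d by rewrite -[n.+1]addn1 natrD; ring.
by rewrite cosD cosB; ring.
Qed.

(** Multiplication by 2 - 2 cos d acts on Fourier coefficients as [diff2]; the last two terms come
    from the truncation at n, and evenness settles the coefficient at 0. *)
Lemma cos_poly_by_parts A n d : (forall t, A (- t) = A t) ->
  (2 - 2 * cos d) * cos_poly A n d = cos_poly (diff2 A) n d +
    2 * A n.+1%:R * cos (n%:R * d) - 2 * A n%:R * cos (n.+1%:R * d).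
Proof.
move=> Ae; rewrite /cos_poly; elim: n => [|n IH].
  rewrite !big_ord0 /diff2 !add0r (Ae 1) mul0r cos0 mul1r; ring.
rewrite !big_ord_recr /= !(mulrDr 2) !addrA [in LHS]mulrDr IH.
rewrite [diff2 A n.+1%:R]/diff2 natr1 (_ : n.+1%:R - 1 = n%:R); last by rewrite -natr1 addrK.
by rewrite cos_addn2; ring.
Qed.

Lemma diff2_even A : (forall t, A (- t) = A t) -> forall t, diff2 A (- t) = diff2 A t.
Proof.
move=> Ae t; rewrite /diff2 Ae -(Ae (- t + 1)) -(Ae (- t - 1)) opprD opprK.
by rewrite (_ : - (- t - 1) = t + 1); [ring|ring].
Qed.

Lemma cos_poly_norm_le A n d (c : R) : (forall k, (k <= n)%N -> `|A k%:R| <= c) ->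
  `|cos_poly A n d| <= c * (1 + 2 * n%:R).
Proof.
move=> Ac; rewrite /cos_poly; apply: (le_trans (ler_normD _ _)).
rewrite mulrDr mulr1 lerD//; first exact: (Ac 0%N).
rewrite normrM ger0_norm// mulrCA ler_pM2l//.
apply: (le_trans (ler_norm_sum _ _ _)).
apply: (@le_trans _ _ (\sum_(k < n) c)); last first.
  by rewrite sumr_const card_ord mulr_natr.
apply: ler_sum => k _; rewrite normrM -[leRHS]mulr1.
by apply: ler_pM => //; [exact: Ac|exact: cos_max].
Qed.

Variable N : nat.
Hypothesis N0 : (0 < N)%N.
Let v : R := N%:R^-1.

(* The triple zero at N makes every boundary term of two summations by parts
   O(N^-3), as small as the interior contribution. *)
Definition cutoff (t : R) : R := (1 - (t / N%:R) ^+ 2) ^+ 3.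

Let Nv : N%:R * v = 1.
Proof. by rewrite /v mulfV// pnatr_eq0 -lt0n. Qed.

Let v01 : 0 < v <= 1.
Proof. by rewrite invr_gt0 ltr0n N0/= invf_le1 ?ltr0n// ler1n. Qed.

Lemma cutoff_even t : cutoff (- t) = cutoff t.
Proof. by rewrite /cutoff mulNr sqrrN. Qed.

(** The cutoff has degree 6, so its fourth difference is quadratic in t and of order N^-4 on |t| <=
    N; summing over 2 N + 1 frequencies then gives N^-3. *)
Lemma diff2_diff2_cutoff t : diff2 (diff2 cutoff) t =
  72 * v ^+ 4 - (360 * t ^+ 2 + 120) * v ^+ 6.
Proof. by rewrite /diff2 /cutoff -/v; ring. Qed.

Lemma cutoff_ge0_le1 k : (k <= N)%N -> 0 <= cutoff k%:R <= 1.
Proof.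
move=> kN; have k1 : k%:R / N%:R <= 1 :> R by rewrite ler_pdivrMr ?ltr0n// mul1r ler_nat.
have k0 : 0 <= k%:R / N%:R :> R by rewrite divr_ge0.
have h : 0 <= 1 - (k%:R / N%:R : R) ^+ 2 <= 1 by apply/andP; split; nra.
by case/andP: h => h0 h1; rewrite exprn_ge0//= exprn_ile1.
Qed.

Lemma kernel_decay d : (2 - 2 * cos d) ^+ 2 * `|cos_poly cutoff N d| <= 3100 * v ^+ 3.
Proof.
have c1 := cos_max d; have c2 : 0 <= 2 - 2 * cos d <= 4.
  by have := cos_le1 d; have := cos_geN1 d; lra.
rewrite -[leLHS](_ : `|(2 - 2 * cos d) ^+ 2 * cos_poly cutoff N d| = _); last first.
  by rewrite normrM ger0_norm// sqr_ge0.
rewrite expr2 -mulrA (cos_poly_by_parts _ _ cutoff_even).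
have -> : cutoff N%:R = 0 by rewrite /cutoff -/v Nv; ring.
rewrite mulr0 mul0r subr0 mulrDr (cos_poly_by_parts _ _ (diff2_even cutoff_even)).
have /andP[v0 v1] := v01.
have v3 : 0 <= v ^+ 3 by exact/exprn_ge0/ltW.
(* This is the triple zero at N in explicit form: boundary values at distance c from N are
   O(v^3). *)
have cE (c : R) : cutoff (N%:R + c) = - (2 * c * v + c ^+ 2 * v ^+ 2) ^+ 3.
  by rewrite /cutoff -/v mulrDl Nv; ring.
have cN : diff2 cutoff N%:R = (2 * v + v ^+ 2) ^+ 3 + (- 2 * v + v ^+ 2) ^+ 3.
  have := cE 0; rewrite /diff2 addr0 => ->; rewrite !cE; ring.
have cN1 : diff2 cutoff N.+1%:R = - 2 * (2 * v + v ^+ 2) ^+ 3 + (4 * v + 4 * v ^+ 2) ^+ 3.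
  rewrite /diff2 -[N.+1%:R]natr1 -!addrA subrr addr0 !cE; have := cE 0.
  by rewrite addr0 => ->; ring.
have vle n : (3 <= n)%N -> 0 <= v ^+ n <= v ^+ 3.
  by move=> n3; rewrite exprn_ge0 ?ler_wiXn2l//; lra.
have /andP[v40 v4] := vle 4%N isT; have /andP[v50 v5] := vle 5%N isT.
have /andP[v60 v6] := vle 6%N isT.
have e1 : `|cutoff N.+1%:R| <= 27 * v ^+ 3.
  by rewrite -natr1 cE normrN ger0_norm ?exprn_ge0//; [lra|nra].
have e2 : `|diff2 cutoff N%:R| <= 35 * v ^+ 3.
  by rewrite cN ler_norml; apply/andP; split; lra.
have e3 : `|diff2 cutoff N.+1%:R| <= 566 * v ^+ 3.
  by rewrite cN1 ler_norml; apply/andP; split; lra.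
have e4 : `|cos_poly (diff2 (diff2 cutoff)) N d| <= 1656 * v ^+ 3.
  apply: (le_trans (cos_poly_norm_le (c := 552 * v ^+ 4) _ _)) => [k kN|].
    rewrite diff2_diff2_cutoff.
    have kv : 0 <= (k%:R * v) ^+ 2 <= 1.
      have : k%:R * v <= 1 by rewrite ler_pdivrMr ?ltr0n// mul1r ler_nat.
      by have : 0 <= k%:R * v by [rewrite mulr_ge0//; lra]; move=> *; apply/andP; split; nra.
    have h : (360 * k%:R ^+ 2 + 120) * v ^+ 6 = 360 * ((k%:R * v) ^+ 2 * v ^+ 4) + 120 * v ^+ 6 by ring.
    rewrite h; have : v ^+ 6 <= v ^+ 4 by rewrite ler_wiXn2l//; lra.
    have : 0 <= (k%:R * v) ^+ 2 * v ^+ 4 <= v ^+ 4.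
      by case/andP: kv => k0 k1; rewrite mulr_ge0//= ler_piMl.
    by rewrite ler_norml => /andP[a b] c'; apply/andP; split; lra.
  rewrite (_ : _ * _ = 552 * v ^+ 3 * (v + 2 * (N%:R * v))); last by ring.
  by rewrite Nv; nra.
have := cos_max (N%:R * d); have := cos_max (N.+1%:R * d).
set C1 := cos (N.+1%:R * d); set C2 := cos (N%:R * d) => h1 h2.
have n1 (a c k : R) : `|a| <= k * v ^+ 3 -> `|c| <= 1 -> `|a * c| <= k * v ^+ 3.
  move=> ha hc; rewrite normrM; apply: (le_trans _ ha).
  by rewrite ler_piMr.
have m1 := n1 _ _ _ e1 h2; have m2 := n1 _ _ _ e3 h2; have m3 := n1 _ _ _ e2 h1.
have m4 : `|(2 - 2 * cos d) * (cutoff N.+1%:R * C2)| <= 108 * v ^+ 3.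
  rewrite normrM ger0_norm; last by lra.
  case/andP: c2 => c20 c24.
  by apply: (le_trans (ler_pM c20 (normr_ge0 _) c24 m1)); lra.
(* The interior sum and the doubled boundary terms add up to 1656 + 2 * 566 + 2 * 35 + 2 * 108 =
   3074. *)
move: e4 m2 m3 m4; rewrite !ler_norml => /andP[? ?] /andP[? ?] /andP[? ?] /andP[? ?].
by apply/andP; split; lra.
Qed.

(** With y = d / 2 <= 2, the cubic Taylor bound gives sin y >= y - y^3 / 6 >= y / 3, and 2 - 2 cos d
    = 4 sin(y)^2. *)
Lemma sqr_le_one_sub_cos d : 0 <= d <= pi -> d ^+ 2 / 9 <= 2 - 2 * cos d.
Proof.
move=> /andP[d0 dpi].
have -> : 2 - 2 * cos d = 4 * sin (d / 2) ^+ 2.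
  rewrite {1}(_ : d = (d / 2) *+ 2); last by rewrite -mulr_natr divfK.
  by rewrite cos_mulr2n; have := cos2Dsin2 (d / 2); rewrite -mulr_natr; lra.
have h0 : 0 <= d / 2 by rewrite divr_ge0.
have h2 : d / 2 <= 2 by have := pihalf_lt2 R; lra.
have := sin_ge_cube h0; set y := d / 2 in h0 h2 *.
have -> : d = 2 * y by rewrite /y; field.
set s := sin y => hs; have ys : y / 3 <= s.
  apply: le_trans hs; rewrite (_ : y ^+ 3 = y * y ^+ 2); last by ring.
  have y4 : y ^+ 2 <= 4 by nra.
  by nra.
nra.
Qed.

(** For N d <= 1 the trivial bound 3 N is enough. Beyond that, [kernel_decay] gives 81 * 3100 N (N
    d)^-4, and the factor 8 of [add1_cube_le] brings the constant to 2008800. *)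
Lemma kernel_le d : 0 <= d <= pi ->
  `|cos_poly cutoff N d| <= 2100 * 1000 * N%:R / (N%:R * d + 1) ^+ 3.
Proof.
move=> d0pi; have /andP[d0 dpi] := d0pi.
have n0 : 0 < N%:R :> R by rewrite ltr0n.
have n1 : 1 <= N%:R :> R by rewrite ler1n.
have y0 : 0 <= N%:R * d by rewrite mulr_ge0// ltW.
rewrite ler_pdivlMr ?exprn_gt0//; last by lra.
have [y1|y1] := leP (N%:R * d) 1.
  have h1 : `|cos_poly cutoff N d| <= 3 * N%:R.
    apply: (le_trans (cos_poly_norm_le (c := 1) _ _)) => [k kN|]; last by lra.
    by have /andP[k0 k1] := cutoff_ge0_le1 kN; rewrite ger0_norm.
  have h2 : (N%:R * d + 1) ^+ 3 <= 8.
    rewrite (_ : 8 = 2 ^+ 3); last by ring.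
    by apply: lerXn2r; rewrite ?nnegrE; lra.
  apply: (le_trans (ler_pM (normr_ge0 _) _ h1 h2)); last by lra.
  by apply: exprn_ge0; lra.
have h := kernel_decay d; set J := `|_| in h *.
have J0 : 0 <= J by exact: normr_ge0.
have h1 : (d ^+ 2 / 9) ^+ 2 * J <= 3100 * v ^+ 3.
  have q0 : 0 <= d ^+ 2 / 9 by rewrite divr_ge0// sqr_ge0.
  have q1 := sqr_le_one_sub_cos d0pi.
  have q2 := le_trans q0 q1.
  by apply: le_trans h; apply: ler_wpM2r => //; apply: lerXn2r.
have h2 : (N%:R * d) ^+ 4 * J <= 2511 * 100 * N%:R.
  have -> : (N%:R * d) ^+ 4 * J = 81 * N%:R ^+ 4 * ((d ^+ 2 / 9) ^+ 2 * J) by field.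
  have -> : 2511 * 100 * N%:R = 81 * N%:R ^+ 4 * (3100 * v ^+ 3).
    have -> : 81 * N%:R ^+ 4 * (3100 * v ^+ 3) = 2511 * 100 * N%:R * (N%:R * v) ^+ 3 by ring.
    by rewrite Nv expr1n mulr1.
  by rewrite ler_wpM2l// mulr_ge0// exprn_ge0// ltW.
set y := N%:R * d in y0 y1 h2 *.
have h3 := add1_cube_le (ltW y1).
rewrite mulrC; apply: (le_trans (ler_wpM2r J0 h3)); rewrite -mulrA; lra.
Qed.

(** The smoothed Fourier sum of the sawtooth pi - d on (0, 2 pi). Since [cutoff] is 1 at 0, the
    derivative of d + [sin_poly] d is exactly the kernel [cos_poly cutoff]. *)
Definition sin_poly d : R :=
  2 * \sum_(k < N) cutoff k.+1%:R * (sin (k.+1%:R * d) / k.+1%:R).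

Lemma is_derive_sin_poly d :
  is_derive d 1 (fun y => y + sin_poly y) (cos_poly cutoff N d).
Proof.
have c0 : cutoff 0 = 1 by rewrite /cutoff mul0r expr0n /= subr0 expr1n.
rewrite /cos_poly c0; apply: (@isdD _ (fun y => y) sin_poly _ _ _ (isd_id d)).
rewrite /sin_poly; eapply is_derive_eq.
  eapply isdM; first exact: isd_cst.
  rewrite (_ : (fun y => _) = \sum_(k < N)
    (fun y : R => cutoff k.+1%:R * (sin (k.+1%:R * y) / k.+1%:R))); last first.
    by apply/funext => y; rewrite fct_sumE.
  eapply is_derive_sum => k; eapply isdM; first exact: isd_cst.
  eapply isdM; last exact: isd_cst.
  by eapply isd_sin; eapply isdM; [exact: isd_cst|exact: isd_id].
rewrite /= [X in _ + X = _]mulr0 addr0; congr (2 * _); apply: eq_bigr => k _.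
have k0 : k.+1%:R != 0 :> R by rewrite pnatr_eq0.
by field.
Qed.

Lemma sin_natr_pi (k : nat) : sin (k%:R * pi) = 0 :> R.
Proof.
elim: k => [|k IH]; first by rewrite mul0r sin0.
by rewrite -natr1 mulrDl mul1r sinDpi IH oppr0.
Qed.

Lemma sin_poly_pi : sin_poly pi = 0.
Proof.
by rewrite /sin_poly big1 ?mulr0// => k _; rewrite sin_natr_pi mul0r mulr0.
Qed.

(** As [sin_poly] vanishes at pi, the error at d is the integral of the kernel from d to pi. Instead
    of integrating, the primitive is compared with that of the bound, once for each sign [s]. *)
Lemma sin_poly_approx (M : R) : 0 <= M ->
  (forall d, 0 <= d <= pi ->
    `|cos_poly cutoff N d| <= 2 * M * N%:R / (N%:R * d + 1) ^+ 3) ->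
  forall d, 0 <= d <= pi ->
  `|pi - d - sin_poly d| <= M / (N%:R * d + 1) ^+ 2.
Proof.
move=> M0 hM d /andP[d0 dpi].
have n0 : 0 < N%:R :> R by rewrite ltr0n.
pose g (y : R) : R := M * ((N%:R * y + 1) ^+ 2)^-1.
pose g' (y : R) : R := - (2 * M * N%:R / (N%:R * y + 1) ^+ 3).
have pos (y : R) : 0 <= y -> 0 < N%:R * y + 1.
  by move=> y0; rewrite ltr_wpDl// mulr_ge0// ltW.
have dg (y : R) : 0 <= y -> is_derive y 1 g (g' y).
  move=> y0; have p := pos y y0.
  have d1 : is_derive y 1 (fun y : R => (N%:R * y + 1) ^+ 2) (2 * (N%:R * y + 1) * N%:R).
    by isd; ring.
  have p2 : (N%:R * y + 1) ^+ 2 != 0 by rewrite expf_neq0// gt_eqF.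
  have d2 := @is_deriveV _ (fun y : R => (N%:R * y + 1) ^+ 2) _ _ _ p2 d1.
  have d3 := isdM (isd_cst (M) y) d2.
  apply: (is_derive_eq d3); rewrite /= /g' /GRing.scale /=; field.
  by rewrite gt_eqF.
have gpi : 0 <= g pi by rewrite /g mulr_ge0// invr_ge0 sqr_ge0.
have bound (s : R) : s = 1 \/ s = -1 -> s * (pi - d - sin_poly d) <= g d.
  move=> hs; pose f (y : R) := s * (y + sin_poly y) + - (s * (d + sin_poly d)).
  pose h (y : R) := g d + - g y.
  have df (y : R) : is_derive y 1 f (s * cos_poly cutoff N y).
    rewrite /f; eapply is_derive_eq.
      eapply isdD; last exact: isd_cst.
      by eapply isdM; [exact: isd_cst|exact: is_derive_sin_poly].
    by rewrite mulr0 !addr0.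
  have dh (y : R) : 0 <= y -> is_derive y 1 h (- g' y).
    move=> y0; rewrite /h; eapply is_derive_eq.
      by eapply isdD; [exact: isd_cst|eapply isdN; exact: dg].
    by rewrite add0r.
  suff : f pi <= h pi.
    rewrite /f /h sin_poly_pi addr0 => H.
    have -> : s * (pi - d - sin_poly d) = s * pi + - (s * (d + sin_poly d)) by ring.
    by apply: (le_trans H); rewrite gerDl oppr_le0.
  apply: (@is_derive_le _ f (fun y => s * cos_poly cutoff N y) h (fun y => - g' y) d pi).
  - exact: dpi.
  - by move=> y /andP[dy _]; apply: dh; apply: ltW; exact: le_lt_trans dy.
  - apply: derivable_within_continuous => y _; have := df y => ?; exact: ex_derive.
  - apply: derivable_within_continuous => y; rewrite in_itv /= => /andP[dy _].
    by have := dh y (le_trans d0 dy) => ?; exact: ex_derive.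
  - move=> y /andP[dy ypi]; rewrite /g' opprK.
    have hy : 0 <= y <= pi by rewrite (le_trans d0 (ltW dy)) ltW.
    apply: (le_trans _ (hM _ hy)).
    by case: hs => ->; [rewrite mul1r|rewrite mulN1r -normrN]; exact: ler_norm.
  - by rewrite /f /h !subrr.
rewrite ler_norml.
have := bound 1 (or_introl erefl); have := bound (-1) (or_intror erefl).
rewrite mul1r mulN1r /g => h1 h2; apply/andP; split; lra.
Qed.

End smooth_cutoff.

(** * Fejer kernels and the periodic sawtooth *)

Section sawtooth.
Context (R : realType).
Implicit Types (phi t z delta : R).

Lemma cos_sin_int_period (m : int) t :
  cos (t + 2 * pi * m%:~R) = cos t /\ sin (t + 2 * pi * m%:~R) = sin t.
Proof.
have nat_case (n : nat) (s : R) : cos (s + 2 * pi * n%:R) = cos s /\ sin (s + 2 * pi * n%:R) = sin s.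
  rewrite (_ : 2 * pi * n%:R = (pi *+ 2) *+ n); last by rewrite -(mulr_natl pi) mulr_natr.
  by split; [exact: (periodicn (@cosD2pi R))|exact: (periodicn (@sinD2pi R))].
case: m => n; first exact: nat_case.
have [<- <-] := nat_case n.+1 (t + 2 * pi * (Negz n)%:~R).
by rewrite NegzE intrN mulrN addrNK.
Qed.

(** The squared modulus of the sum of e^(i j phi) over j < n, that is, n times the usual Fejer
    kernel. *)
Definition fejer (n : nat) phi : R :=
  (\sum_(j < n) cos (j%:R * phi)) ^+ 2 + (\sum_(j < n) sin (j%:R * phi)) ^+ 2.

Lemma fejer_ge0 n phi : 0 <= fejer n phi.
Proof. by rewrite addr_ge0// sqr_ge0. Qed.

Lemma fejer_double_sum n phi :
  fejer n phi = \sum_(p : 'I_n * 'I_n) cos ((p.1%:R - p.2%:R) * phi).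
Proof.
rewrite /fejer !expr2 !big_distrlr /= -big_split /= -(pair_bigA _
  (fun i j : 'I_n => cos ((i%:R - j%:R) * phi))) /=.
apply: eq_bigr => i _; rewrite -big_split; apply: eq_bigr => j _.
by rewrite mulrBl cosB.
Qed.

Lemma fejer_closed n phi : (2 - 2 * cos phi) * fejer n phi = 2 - 2 * cos (n%:R * phi).
Proof.
have cs := cos2Dsin2 phi; have cs' := cos2Dsin2 (n%:R * phi).
(* Real and imaginary parts of the geometric sum identity, multiplied by e^(i phi) - 1. *)
suff [h1 h2] : (cos phi - 1) * (\sum_(j < n) cos (j%:R * phi)) -
      sin phi * (\sum_(j < n) sin (j%:R * phi)) = cos (n%:R * phi) - 1 /\
    sin phi * (\sum_(j < n) cos (j%:R * phi)) +
      (cos phi - 1) * (\sum_(j < n) sin (j%:R * phi)) = sin (n%:R * phi).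
  have -> : 2 - 2 * cos (n%:R * phi) = (cos (n%:R * phi) - 1) ^+ 2 + sin (n%:R * phi) ^+ 2.
    by rewrite sqrrB1 -addrA addrC; lra.
  have -> : 2 - 2 * cos phi = (cos phi - 1) ^+ 2 + sin phi ^+ 2 by rewrite sqrrB1; lra.
  by rewrite -h1 -h2 /fejer; ring.
clear cs'; elim: n => [|n [IH1 IH2]]; first by rewrite !big_ord0 mul0r cos0 sin0 !mulr0; split; ring.
have -> : n.+1%:R * phi = n%:R * phi + phi by rewrite -natr1 mulrDl mul1r.
rewrite !big_ord_recr /= cosD sinD; split.
  have -> : cos (n%:R * phi) * cos phi - sin (n%:R * phi) * sin phi - 1 =
    (cos (n%:R * phi) - 1) + (cos phi - 1) * cos (n%:R * phi) - sin phi * sin (n%:R * phi) by ring.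
  by rewrite -IH1; ring.
have -> : sin (n%:R * phi) * cos phi + cos (n%:R * phi) * sin phi =
  sin (n%:R * phi) + sin phi * cos (n%:R * phi) + (cos phi - 1) * sin (n%:R * phi) by ring.
by rewrite -IH2; ring.
Qed.

Lemma fejer_period n (m : int) phi : fejer n (phi + 2 * pi * m%:~R) = fejer n phi.
Proof.
have e (j : nat) : j%:R * (phi + 2 * pi * m%:~R) = j%:R * phi + 2 * pi * (j%:Z * m)%:~R.
  by rewrite intrM mulrDr; congr (_ + _); rewrite -[(j%:Z)%:~R]/(j%:R); ring.
by rewrite /fejer; congr (_ ^+ 2 + _ ^+ 2); apply: eq_bigr => j _; rewrite e;
  have [] := cos_sin_int_period (j%:Z * m) (j%:R * phi).
Qed.

Lemma one_sub_cos_le_sqr t : 2 - 2 * cos t <= t ^+ 2.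
Proof.
have h : 2 - 2 * cos `|t| <= `|t| ^+ 2 by have := cos_ge1Bsqr (normr_ge0 t); lra.
by move: h; rewrite cos_norm real_normK ?num_real.
Qed.

Definition fejer2 n phi : R := fejer n phi + fejer n (phi + pi / n%:R).

(* The zeros of the two Fejer kernels interlace, so their sum has no zeros. *)
Lemma fejer2_lower n phi : (0 < n)%N ->
  1 / (n%:R * `|phi| + 1) ^+ 2 <= 4 / n%:R ^+ 2 * fejer2 n phi.
Proof.
move=> n0; have nr : 0 < n%:R :> R by rewrite ltr0n.
set q := `|phi| + pi / n%:R; have pn0 : 0 < pi / n%:R :> R by rewrite divr_gt0// pi_gt0.
have a0 := normr_ge0 phi.
have q0 : 0 < q by rewrite ltr_wpDl.
have h1 := fejer_closed n phi; have h2 := fejer_closed n (phi + pi / n%:R).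
have e : cos (n%:R * (phi + pi / n%:R)) = - cos (n%:R * phi).
  by rewrite -cosDpi; congr cos; field; rewrite gt_eqF.
rewrite e in h2.
have g1 : 2 - 2 * cos phi <= q ^+ 2.
  apply: (le_trans (one_sub_cos_le_sqr _)); rewrite -[phi ^+ 2]real_normK ?num_real//.
  by rewrite lerXn2r ?nnegrE ?(ltW q0)// lerDl ltW.
have g2 : 2 - 2 * cos (phi + pi / n%:R) <= q ^+ 2.
  apply: (le_trans (one_sub_cos_le_sqr _)); rewrite -[(phi + _) ^+ 2]real_normK ?num_real//.
  rewrite lerXn2r ?nnegrE ?(ltW q0)//; apply: (le_trans (ler_normD _ _)).
  by rewrite lerD2l ger0_norm// ltW.
(* The shift by pi / n changes the sign of cos(n phi), so the two numerators 2 - 2 cos(n phi) and 2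
   + 2 cos(n phi) add up to 4, while [q] bounds both |phi| and |phi + pi / n|. *)
have key : 4 <= q ^+ 2 * fejer2 n phi.
  rewrite /fejer2 mulrDr.
  have := ler_wpM2r (fejer_ge0 n phi) g1.
  have := ler_wpM2r (fejer_ge0 n (phi + pi / n%:R)) g2.
  rewrite h1 h2; lra.
have F0 : 0 <= fejer2 n phi by rewrite addr_ge0// fejer_ge0.
have hq : n%:R * q <= 4 * (n%:R * `|phi| + 1).
  have -> : n%:R * q = n%:R * `|phi| + pi by rewrite /q; field; rewrite gt_eqF.
  have := pihalf_lt2 R; have : 0 <= n%:R * `|phi| by rewrite mulr_ge0// ltW.
  lra.
set b := n%:R * `|phi| + 1 in hq *.
have b0 : 0 < b by rewrite ltr_wpDl// mulr_ge0// ltW.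
rewrite ler_pdivrMr ?exprn_gt0//.
rewrite (_ : 4 / _ * _ * _ = 4 * fejer2 n phi * b ^+ 2 / n%:R ^+ 2); last first.
  by field; rewrite gt_eqF.
rewrite ler_pdivlMr ?exprn_gt0// mul1r.
have : (n%:R * q) ^+ 2 <= (4 * b) ^+ 2 by rewrite lerXn2r ?nnegrE// mulr_ge0// ltW.
rewrite !exprMn => hh.
have n2 : 0 <= n%:R ^+ 2 :> R by exact: sqr_ge0.
have s1 := ler_wpM2l n2 key.
have s2 := ler_wpM2r F0 hh.
lra.
Qed.

Lemma sin_poly_period (N : nat) (m : int) y :
  sin_poly N (y + 2 * pi * m%:~R) = sin_poly N y :> R.
Proof.
rewrite /sin_poly; congr (2 * _); apply: eq_bigr => k _; congr (_ * (_ / _)).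
rewrite (_ : k.+1%:R * _ = k.+1%:R * y + 2 * pi * (k.+1%:Z * m)%:~R); last first.
  by rewrite intrM mulrDr; congr (_ + _); rewrite -[(k.+1%:Z)%:~R]/(k.+1%:R); ring.
by have [] := cos_sin_int_period (k.+1%:Z * m) (k.+1%:R * y).
Qed.

Lemma sin_polyN (N : nat) y : sin_poly N (- y) = - sin_poly N y :> R.
Proof.
rewrite /sin_poly -mulrN -sumrN; congr (2 * _); apply: eq_bigr => k _.
by rewrite mulrN sinN mulNr mulrN.
Qed.

(** With n the quantizer index and d = y + 2 pi n, the scaled error is exactly pi - d, and the
    rounding convention places d in [0, 2 pi). The right-hand side has period 2 pi, so it can be
    evaluated at d. *)
Lemma quantizer_error_approx : exists2 M : R, 0 < M &
  forall delta z (N : nat) (y := pi - 2 * pi * (z / delta)),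
  0 < delta -> (0 < N)%N ->
  `|2 * pi / delta * (z - quantizer delta z) - sin_poly N y| <=
  M / N%:R ^+ 2 * fejer2 N y.
Proof.
have [M M0 HM] : exists2 M : R, 0 < M & forall N d, (0 < N)%N -> 0 <= d <= pi ->
    `|pi - d - sin_poly N d| <= M / (N%:R * d + 1) ^+ 2.
  have [M M0 ME] : exists2 M : R, 0 < M & 2 * M = 2100 * 1000.
    by exists (1050 * 1000); [lra|ring].
  exists M => // N d N0; apply: (sin_poly_approx N0 (ltW M0)) => {}d hd.
  by rewrite ME; exact: kernel_le.
exists (4 * M); first by rewrite mulr_gt0.
move=> delta z N y delta0 N0; rewrite /quantizer; set n := Num.ceil _.
pose d := y + 2 * pi * n%:~R.
have -> : 2 * pi / delta * (z - n%:~R * delta) = pi - d.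
  by rewrite /d /y; field; rewrite gt_eqF.
have d02 : 0 <= d < 2 * pi.
  have /andP[] := ceil_itv (z / delta - 2^-1); rewrite -/n.
  rewrite intrB => lo hi.
  have -> : d = 2 * pi * (1 / 2 - (z / delta - n%:~R)) by rewrite /d /y; field; rewrite gt_eqF.
  have p0 := pi_gt0 R; apply/andP; split; first by rewrite !mulr_ge0//; lra.
  rewrite -[ltRHS]mulr1 ltr_pM2l; [lra|by rewrite mulr_gt0].
rewrite -(sin_poly_period N n) -/d -(_ : fejer2 N d = fejer2 N y); last first.
  by rewrite /fejer2 /d fejer_period [y + _ + _]addrAC fejer_period.
have main phi : fejer2 N phi = fejer2 N d -> `|pi - d - sin_poly N d| =
    `|pi - `|phi| - sin_poly N `|phi| | -> 0 <= `|phi| <= pi ->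
    `|pi - d - sin_poly N d| <= 4 * M / N%:R ^+ 2 * fejer2 N d.
  move=> <- -> hphi; apply: (le_trans (HM _ _ N0 hphi)).
  have := ler_wpM2l (ltW M0) (fejer2_lower phi N0).
  by rewrite mulrA mulr1 !mulrA [M * 4]mulrC.
have /andP[d0 d2] := d02.
have [dpi|dpi] := leP d pi.
  by apply: (main d) => //; rewrite (ger0_norm d0)// d0 dpi.
(* Past pi, d - 2 pi has absolute value at most pi, and since the sawtooth and [sin_poly] are both
   odd the error there is the same up to sign. *)
apply: (main (d - 2 * pi)).
- rewrite -[in RHS](subrK (2 * pi) d) /fejer2.
  have e (s : R) : fejer N (s + 2 * pi) = fejer N s.
    by have := fejer_period N 1 s; rewrite mulr1.
  by rewrite e [_ + 2 * pi + _]addrAC e.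
- rewrite (@ltr0_norm _ (d - 2 * pi)); last by lra.
  have -> : sin_poly N (- (d - 2 * pi)) = - sin_poly N d.
    rewrite sin_polyN; congr (- _); have := sin_poly_period N (-1) d.
    by rewrite mulrN1.
  rewrite -normrN; congr (`|_|); ring.
- by rewrite normr_ge0 (@ler0_norm _ (d - 2 * pi)); lra.
Qed.

End sawtooth.

(** * Finite sums *)

Section finite_sums.
Context (R : realType).

(** The induction carries the sharper bound 2 - 1 / n, whose increments telescope. *)
Lemma sum_inv_sqr_le n : \sum_(k < n) (k.+1%:R ^+ 2)^-1 <= 2 :> R.
Proof.
case: n => [|n]; first by rewrite big_ord0.
suff h : \sum_(k < n.+1) (k.+1%:R ^+ 2)^-1 <= 2 - n.+1%:R^-1 :> R.
  by apply: (le_trans h); rewrite gerDl oppr_le0 invr_ge0.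
elim: n => [|n IH].
  by rewrite big_ord_recl big_ord0 /= expr1n invr1 addr0 (_ : 2 - 1 = 1)//; ring.
rewrite big_ord_recr /=; apply: (le_trans (lerD IH (lexx _))).
have a0 : 0 < n.+1%:R :> R by [].
rewrite -[n.+2%:R]natr1; set a := n.+1%:R in a0 *.
suff h : ((a + 1) ^+ 2)^-1 <= a^-1 - (a + 1)^-1.
  rewrite (_ : 2 - (a + 1)^-1 = 2 - a^-1 + (a^-1 - (a + 1)^-1)); last by ring.
  by rewrite lerD2l.
have -> : a^-1 - (a + 1)^-1 = (a * (a + 1))^-1.
  by field; rewrite !gt_eqF//; lra.
have a1 : 0 < a + 1 by rewrite addr_gt0.
rewrite lef_pV2 ?posrE ?mulr_gt0 ?exprn_gt0//.
by rewrite expr2 ler_pM2r// lerDl.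
Qed.

Lemma sum_inv_sqr_dist_le n (j : 'I_n) :
  \sum_(l < n | l != j) ((j%:R - l%:R) ^+ 2)^-1 <= 4 :> R.
Proof.
rewrite (bigID (fun l : 'I_n => l < j)%N) /= (_ : 4 = 2 + 2 :> R); last by ring.
apply: lerD.
  rewrite (eq_bigl (fun l : 'I_n => l < j)%N); last first.
    by move=> l; rewrite -val_eqE /=; case: ltngtP.
  rewrite -(big_ord_widen n (fun l => ((j%:R - l%:R) ^+ 2)^-1)); last exact: ltnW.
  rewrite (reindex_inj rev_ord_inj) /=; apply: le_trans (sum_inv_sqr_le j).
  apply: ler_sum => k _; rewrite (_ : j%:R - (j - k.+1)%:R = k.+1%:R)//.
  by rewrite natrB// opprB addrC subrK.
rewrite (eq_bigl (fun l : 'I_n => j < l)%N); last first.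
  by move=> l; rewrite -val_eqE /=; case: ltngtP.
rewrite -(big_mkord (fun l => j < l)%N (fun l => ((j%:R - l%:R) ^+ 2)^-1)).
rewrite (@big_cat_nat _ _ _ j.+1) //= big_nat_cond big_pred0; last first.
  by move=> l; rewrite ltnS andbC; case: ltngtP.
rewrite add0r -{1}[j.+1]add0n big_addn big_mkord.
apply: le_trans (sum_inv_sqr_le (n - j.+1)); rewrite big_mkcond /=.
apply: ler_sum => k _; case: ifP => // _.
have -> : (j%:R - (k + j.+1)%:R) ^+ 2 = k.+1%:R ^+ 2 :> R.
  by rewrite natrD -[j.+1%:R]natr1 -[k.+1%:R]natr1; ring.
by [].
Qed.

Lemma alternating_sum_bounds n (g : nat -> R) : (0 < n)%N ->
  (forall k, (k < n)%N -> 0 <= g k) -> (forall k, (k.+1 < n)%N -> g k.+1 <= g k) ->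
  0 <= \sum_(k < n) (-1) ^+ k * g k <= g 0%N.
Proof.
elim: n g => [//|[|n] IH] g _ g0 gd.
  by rewrite big_ord_recl big_ord0 expr0 mul1r addr0 lexx g0.
rewrite big_ord_recl /= expr0 mul1r.
rewrite (eq_bigr (fun k : 'I_n.+1 => - ((-1) ^+ k * g k.+1))); last first.
  by move=> k _; rewrite exprS mulN1r mulNr.
rewrite sumrN; have /andP[h1 h2] := IH (fun k => g k.+1) isT
  (fun k kn => g0 k.+1 kn) (fun k kn => gd k.+1 kn).
have := gd 0%N isT; rewrite gerDl oppr_le0 h1 andbT subr_ge0.
exact: le_trans.
Qed.

(** The bound mentions [g 1] even for n = 1, hence nonnegativity at every index. *)
Lemma alternating_sum_ge n (g : nat -> R) : (0 < n)%N ->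
  (forall k, 0 <= g k) -> (forall k, (k.+1 < n)%N -> g k.+1 <= g k) ->
  g 0%N - g 1%N <= \sum_(k < n) (-1) ^+ k * g k.
Proof.
case: n => [//|n] _ g0 gd; rewrite big_ord_recl /= expr0 mul1r lerD2l.
rewrite (eq_bigr (fun k : 'I_n => - ((-1) ^+ k * g k.+1))); last first.
  by move=> k _; rewrite exprS mulN1r mulNr.
rewrite sumrN lerN2; case: n gd => [|n] gd; first by rewrite big_ord0.
by have /andP[] := @alternating_sum_bounds n.+1 (fun k => g k.+1) isT
  (fun k _ => g0 k.+1) (fun k kn => gd k.+1 kn).
Qed.

End finite_sums.

Section quantizer.
Context (R : realType).
Variable delta : R.
Hypothesis delta0 : 0 < delta.

Lemma measurable_quantizer : measurable_fun setT (quantizer delta : R -> R).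
Proof.
apply: nondecreasing_measurable => // s t st.
rewrite /quantizer ler_wpM2r ?(ltW delta0)// ler_int le_ceil// lerD2r.
by rewrite ler_wpM2r// invr_ge0 ltW.
Qed.

Lemma quantizer_error_le (z : R) : `|z - quantizer delta z| <= delta / 2.
Proof.
rewrite /quantizer; set n := Num.ceil _.
have /andP[] := ceil_itv (z / delta - 2^-1); rewrite -/n intrB => lo hi.
have -> : z - n%:~R * delta = (z / delta - n%:~R) * delta by field; rewrite gt_eqF.
rewrite normrM (gtr0_norm delta0) [leRHS]mulrC ler_wpM2r ?(ltW delta0)//.
by rewrite ler_norml; apply/andP; split; lra.
Qed.

End quantizer.

(** * Weighted sums of independent variables *)

Section weighted_sum.
Context d (T : measurableType d) (R : realType) (P : probability T R).
Context (I : finType) (e : I -> {RV P >-> R}) (x : I -> R) (rho : R).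
Hypothesis ind : mutually_independent e.
Hypothesis He : forall i, standard_moments P (e i) rho.
Hypothesis rho1 : 1 <= rho.
Hypothesis x1 : \sum_i x i ^+ 2 = 1.
Let eps := \sum_i `|x i| ^+ 3.
Hypothesis eps_small : eps <= 1 / 64.
Let Z w := \sum_i x i * e i w.

Local Open Scope complex_scope.
Local Notation Re := (@complex.Re _).
Local Notation Im := (@complex.Im _).
Local Notation normc := (@Normc.normc _).

(** Up to the factor i^n, the n-th derivative of the characteristic function of [X]. *)
Definition mcharf (n : nat) (X : T -> R) (u : R) : R[i] :=
  cexpectation P (fun w => (X w ^+ n)%:C * cis (u * X w)).

Lemma mcharf0 X u : mcharf 0 X u = charf P X u.
Proof. by congr cexpectation; apply/funext => w; rewrite expr0 mul1r. Qed.

Lemma mcharf_parts n X u : mcharf n X u =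
  (\int[P]_w (X w ^+ n * cos (u * X w))) +i* (\int[P]_w (X w ^+ n * sin (u * X w))).
Proof.
by congr (_ +i* _); apply: eq_Rintegral => w _ /=; ring.
Qed.

Let me i : measurable_fun setT (e i). Proof. exact: sm_measurable (He i). Qed.

Lemma intble_expr i n : (n <= 2)%N -> intble P (fun w => e i w ^+ n).
Proof.
case: n => [|[|[|//]]] _; first exact: intble_cst.
  exact: sm_int1 (He i).
exact: sm_int2 (He i).
Qed.

(** Letting the exponent depend on the coordinate covers with one factorization the weights 1, e_j,
    e_i e_j and e_i^2. *)
Lemma moment_charf (n : I -> nat) t : (forall i, (n i <= 2)%N) ->
  cexpectation P (fun w => (\prod_i e i w ^+ n i)%:C * cis (t * Z w)) =
  \prod_i mcharf (n i) (e i) (t * x i).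
Proof.
move=> n2; pose F i (y : R) := (y ^+ n i)%:C * cis (t * x i * y).
have ReF i y : Re (F i y) = y ^+ n i * cos (t * x i * y) by rewrite /F /=; ring.
have ImF i y : Im (F i y) = y ^+ n i * sin (t * x i * y) by rewrite /F /=; ring.
have mid (u : R) : measurable_fun setT (fun y : R => u * y) by exact: measurable_funM.
rewrite -(cexpectation_prod (F := F) ind); first last.
- move=> i; under eq_fun do rewrite ImF.
  by apply: intbleM_sin; [exact: intble_expr|exact: measurable_funM].
- move=> i; under eq_fun do rewrite ReF.
  by apply: intbleM_cos; [exact: intble_expr|exact: measurable_funM].
- move=> i; under eq_fun do rewrite ImF.
  apply: measurable_funM; first exact: measurable_funX.
  apply: measurableT_comp => //; apply: continuous_measurable_fun.
  exact: continuous_sin.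
- move=> i; under eq_fun do rewrite ReF.
  apply: measurable_funM; first exact: measurable_funX.
  apply: measurableT_comp => //; apply: continuous_measurable_fun.
  exact: continuous_cos.
congr cexpectation; apply/funext => w.
rewrite /F big_split /= rmorph_prod; congr (_ * _).
by rewrite /Z mulr_sumr cis_sum; apply: eq_bigr => i _; rewrite mulrA.
Qed.

(** The purpose of [eps_small]: no coordinate carries much of the variance, so one or two factors
    can be taken out of a product without spoiling its decay. *)
Lemma sqr_coord_le i : x i ^+ 2 <= 1 / 16.
Proof.
have : `|x i| ^+ 3 <= 1 / 64.
  apply: le_trans eps_small; rewrite /eps (bigD1 i)//= lerDl.
  by apply: sumr_ge0 => j _; exact: exprn_ge0.
rewrite -[x i ^+ 2]real_normK ?num_real//; have := normr_ge0 (x i).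
set a := `|x i| => a0 a3; have [h|h] := leP a (1 / 4); first by clear a3; nra.
have a2 : 1 / 16 < a ^+ 2 by clear a3; nra.
have h3 : 1 / 64 < a * a ^+ 2 by nra.
by exfalso; move: a3; rewrite exprS; lra.
Qed.

(** At least 3/4 of the variance remains, which gives - 3 t^2 / 16 in the exponent, and the
    frequency limit is set so that the cubic term costs at most t^2 / 16. *)
Lemma damp_prod t (Q : pred I) : 0 <= t -> 32 * rho * eps * t <= 1 ->
  \sum_(i | ~~ Q i) x i ^+ 2 <= 1 / 4 ->
  \prod_(i | Q i) damp rho (t * x i) <= expR (- (t ^+ 2 / 8)).
Proof.
move=> t0 ht hQ; rewrite /damp -expR_sum ler_expR.
rewrite big_split /= sumrN -big_distrl /=.
have -> : \sum_(i | Q i) (t * x i) ^+ 2 = t ^+ 2 * (1 - \sum_(i | ~~ Q i) x i ^+ 2).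
  rewrite -x1 (bigID Q xpredT) /= addrK mulr_sumr.
  by apply: eq_bigr => i _; rewrite exprMn.
have h3 : \sum_(i | Q i) 2 * rho * `|t * x i| ^+ 3 <= 2 * rho * t ^+ 3 * eps.
  rewrite /eps (bigID Q xpredT) /= mulrDr mulr_sumr -[leLHS]addr0 lerD//.
    rewrite le_eqVlt; apply/orP; left; apply/eqP; apply: eq_bigr => i _.
    by rewrite normrM (ger0_norm t0) exprMn; ring.
  have r0 : 0 <= rho := le_trans ler01 rho1.
  by rewrite !mulr_ge0 ?exprn_ge0//; apply: sumr_ge0 => i _; exact: exprn_ge0.
have h4 : 2 * rho * t ^+ 3 * eps <= t ^+ 2 / 16.
  have -> : 2 * rho * t ^+ 3 * eps = t ^+ 2 / 16 * (32 * rho * eps * t) by field.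
  by rewrite ler_piMr// divr_ge0// sqr_ge0.
have := sqr_ge0 t; set S := \sum_(i | ~~ Q i) _ in hQ *; set V := \sum_(i | Q i) _ in h3 *.
nra.
Qed.

Lemma charf_prod_le t (Q : pred I) : 0 <= t -> 32 * rho * eps * t <= 1 ->
  \sum_(i | ~~ Q i) x i ^+ 2 <= 1 / 4 ->
  normc (\prod_(i | Q i) mcharf 0 (e i) (t * x i)) <= expR (- (t ^+ 2 / 8)).
Proof.
move=> t0 ht hQ; apply: le_trans (damp_prod t0 ht hQ).
rewrite normc_prod; apply: ler_prod => i _; rewrite normc_ge0 mcharf0 /=.
exact: charf_norm_damp.
Qed.

Lemma mcharf1_le i u : normc (mcharf 1 (e i) u) <= 2 * `|u|.
Proof.
rewrite mcharf_parts; apply: (le_trans (normc_le_ReIm _)) => /=.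
have := (int_Mcos_small (He i) u).2; have := (int_Msin_approx (He i) u).2; lra.
Qed.

Lemma mcharf1_approx i u : normc (mcharf 1 (e i) u - 0 +i* u) <= 2 * rho * u ^+ 2.
Proof.
rewrite mcharf_parts; apply: (le_trans (normc_le_ReIm _)) => /=; rewrite subr0.
have := (int_Mcos_small (He i) u).1; have := (int_Msin_approx (He i) u).1; lra.
Qed.

Lemma mcharf2_le i u : normc (mcharf 2 (e i) u) <= 2.
Proof.
rewrite mcharf_parts; apply: (le_trans (normc_le_ReIm _)) => /=.
have I2 := sm_int2 (He i); have mu : measurable_fun setT (fun w => u * e i w) by exact: measurable_funM.
have h1 : `|\int[P]_w (e i w ^+ 2 * cos (u * e i w))| <= 1.
  rewrite -(sm_var (He i)); apply: Rintegral_norm_le => //; first exact: intbleM_cos.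
  by move=> w; rewrite normrM ger0_norm ?sqr_ge0// ler_piMr ?sqr_ge0// cos_max.
have h2 : `|\int[P]_w (e i w ^+ 2 * sin (u * e i w))| <= 1.
  rewrite -(sm_var (He i)); apply: Rintegral_norm_le => //; first exact: intbleM_sin.
  by move=> w; rewrite normrM ger0_norm ?sqr_ge0// ler_piMr ?sqr_ge0// sin_max.
lra.
Qed.

Lemma Rintegral_shift_cos_le (f g : T -> R) (th : R) : intble P f ->
  measurable_fun setT g ->
  `|\int[P]_w (f w * cos (g w + th))| <=
  2 * normc (cexpectation P (fun w => (f w)%:C * cis (g w))).
Proof.
move=> If mg.
have Ic := intbleM_cos If mg; have Is := intbleM_sin If mg.
have -> : \int[P]_w (f w * cos (g w + th)) =
    cos th * \int[P]_w (f w * cos (g w)) + - sin th * \int[P]_w (f w * sin (g w)).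
  rewrite -!RintegralZl// -RintegralD//; [|exact: intbleZ|exact: intbleZ].
  by apply: eq_Rintegral => w _; rewrite cosD; ring.
have -> : cexpectation P (fun w => (f w)%:C * cis (g w)) =
    (\int[P]_w (f w * cos (g w))) +i* (\int[P]_w (f w * sin (g w))).
  by congr (_ +i* _); apply: eq_Rintegral => w _ /=; ring.
set z := _ +i* _.
have [] := normc_ge_ReIm z; rewrite /z /= -/z => h1 h2.
apply: (le_trans (ler_normD _ _)); rewrite !normrM normrN.
have := cos_max th; have := sin_max th.
have := normr_ge0 (\int[P]_w (f w * cos (g w))); have := normr_ge0 (\int[P]_w (f w * sin (g w))).
nra.
Qed.

Let mZ : measurable_fun setT Z.
Proof. by apply: measurable_sum => i; exact: measurable_funM. Qed.

Let mtZ t : measurable_fun setT (fun w => t * Z w).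
Proof. exact: measurable_funM. Qed.

Lemma charf_sum_le t : 0 <= t -> 32 * rho * eps * t <= 1 ->
  normc (cexpectation P (fun w => 1%:C * cis (t * Z w))) <= expR (- (t ^+ 2 / 8)).
Proof.
move=> t0 ht; have := @moment_charf (fun=> 0%N) t (fun=> isT).
rewrite (_ : (fun w => _) = fun w => 1%:C * cis (t * Z w)); last first.
  by apply/funext => w; rewrite big1.
move=> ->; apply: (@charf_prod_le t xpredT) => //; rewrite big_pred0//; lra.
Qed.

(** Off the diagonal, centering makes each of the two special factors at most 2 t |x_i|. With the
    weight |x_i x_j| this produces x_i^2 x_j^2, whose double sum is 1 in any dimension. *)
Lemma cross_moment_le t i j : 0 <= t -> 32 * rho * eps * t <= 1 ->
  `|x i * x j| *
  normc (cexpectation P (fun w => (e i w * e j w)%:C * cis (t * Z w))) <=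
  ((i == j)%:R * 2 * x i ^+ 2 + 4 * t ^+ 2 * (x i ^+ 2 * x j ^+ 2)) *
  expR (- (t ^+ 2 / 8)).
Proof.
move=> t0 ht; have := expR_ge0 (- (t ^+ 2 / 8)).
pose n l := ((l == i) + (l == j))%N.
have n2 l : (n l <= 2)%N by rewrite /n; case: (l == i); case: (l == j).
have := @moment_charf n t n2.
rewrite (_ : (fun w => _) = fun w => (e i w * e j w)%:C * cis (t * Z w)); last first.
  apply/funext => w; congr (_%:C * _).
  under eq_bigr do rewrite exprD; rewrite big_split /=; congr (_ * _).
    by rewrite (bigD1 i)//= eqxx expr1 big1 ?mulr1// => l /negbTE->.
  by rewrite (bigD1 j)//= eqxx expr1 big1 ?mulr1// => l /negbTE->.
move=> -> E0; set E := expR _ in E0 *.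
have [ij|ij] := eqVneq i j.
  rewrite -ij (bigD1 i)//= Normc.normcM mul1r.
  rewrite (eq_bigr (fun l => mcharf 0 (e l) (t * x l))); last first.
    by move=> l li; rewrite /n -ij (negbTE li).
  have : normc (\prod_(l | l != i) mcharf 0 (e l) (t * x l)) <= E.
    apply: (@charf_prod_le t (fun l => l != i)) => //.
    rewrite (eq_bigl (fun l => l == i)); last by move=> l; rewrite negbK.
    by rewrite big_pred1_eq; have := sqr_coord_le i; lra.
  rewrite (_ : n i = 2%N); last by rewrite /n -ij eqxx.
  have := mcharf2_le i (t * x i); rewrite -expr2.
  rewrite (ger0_norm (sqr_ge0 _)).
  set A := normc _; set B := normc _ => hA hB.
  have A0 : 0 <= A by exact: normc_ge0.
  have B0 : 0 <= B by exact: normc_ge0.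
  have xx := sqr_ge0 (x i); rewrite mulrDl -[leLHS]addr0 lerD//.
    by rewrite [2 * _]mulrC -[leRHS]mulrA ler_wpM2l// ler_pM.
  have h4 : 0 <= 4 * t ^+ 2 by apply: mulr_ge0 => //; exact: sqr_ge0.
  exact: (mulr_ge0 (mulr_ge0 h4 (mulr_ge0 xx xx)) E0).
rewrite (bigD1 i)//= (bigD1 j)/=; last by rewrite eq_sym.
rewrite !Normc.normcM mul0r mul0r add0r.
rewrite (eq_bigr (fun l => mcharf 0 (e l) (t * x l))); last first.
  by move=> l /andP[li lj]; rewrite /n (negbTE li) (negbTE lj).
have : normc (\prod_(l | (l != i) && (l != j)) mcharf 0 (e l) (t * x l)) <= E.
  apply: (@charf_prod_le t (fun l => (l != i) && (l != j))) => //.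
  rewrite (bigD1 i) ?eqxx//= (bigD1 j)/=; last by rewrite eqxx andbF eq_sym.
  rewrite big_pred0 ?addr0; last first.
    by move=> l; case: (l == i); case: (l == j).
  by have := sqr_coord_le i; have := sqr_coord_le j; lra.
have := mcharf1_le i (t * x i); have := mcharf1_le j (t * x j).
rewrite (_ : n i = 1%N); last by rewrite /n eqxx (negbTE ij).
rewrite (_ : n j = 1%N); last by rewrite /n eqxx eq_sym (negbTE ij).
set A := normc _; set B := normc _; set D := normc _ => hB hA hD.
have A0 : 0 <= A by exact: normc_ge0.
have B0 : 0 <= B by exact: normc_ge0.
have D0 : 0 <= D by exact: normc_ge0.
apply: (@le_trans _ _ (`|x i * x j| * ((2 * `|t * x i|) * ((2 * `|t * x j|) * E)))).
  by apply: ler_wpM2l => //; apply: ler_pM => //; [exact: mulr_ge0|exact: ler_pM].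
rewrite !normrM (ger0_norm t0) -[x i ^+ 2]real_normK ?num_real// -[x j ^+ 2]real_normK ?num_real//.
by rewrite le_eqVlt; apply/orP; left; apply/eqP; ring.
Qed.

Lemma intble_cross i j : intble P (fun w => e i w * e j w).
Proof.
apply: (@intble_le _ _ _ _ _ (fun w => e i w ^+ 2 + e j w ^+ 2)).
- exact: measurable_funM.
- by apply: intbleD; exact: (sm_int2 (He _)).
- move=> w; rewrite [leRHS]ger0_norm ?addr_ge0 ?sqr_ge0// normrM.
  rewrite -[e i w ^+ 2]real_normK ?num_real// -[e j w ^+ 2]real_normK ?num_real//.
  have := normr_ge0 (e i w); have := normr_ge0 (e j w).
  by have := sqr_ge0 (`|e i w| - `|e j w|); nra.
Qed.

Lemma sum_sqrE w : Z w ^+ 2 = \sum_(p : I * I) x p.1 * x p.2 * (e p.1 w * e p.2 w).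
Proof.
rewrite expr2 {1}/Z /Z big_distrlr /= pair_bigA /=.
by apply: eq_bigr => p _; ring.
Qed.

Lemma intble_sum_sqr : intble P (fun w => Z w ^+ 2).
Proof.
under eq_fun do rewrite sum_sqrE.
by apply: intble_sum => p _; apply: intbleZ; exact: intble_cross.
Qed.

Lemma Rintegral_sum_sqr_cos_le t th : 0 <= t -> 32 * rho * eps * t <= 1 ->
  `|\int[P]_w ((1 + Z w ^+ 2) * cos (t * Z w + th))| <=
  (6 + 8 * t ^+ 2) * expR (- (t ^+ 2 / 8)).
Proof.
move=> t0 ht; set E := expR _.
have Ic1 : intble P (fun w => 1 * cos (t * Z w + th)).
  by apply: intbleM_cos; [exact: intble_cst|exact: measurable_funD].
have Ic2 p : intble P (fun w => e p.1 w * e p.2 w * cos (t * Z w + th)).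
  by apply: intbleM_cos; [exact: intble_cross|exact: measurable_funD].
have -> : \int[P]_w ((1 + Z w ^+ 2) * cos (t * Z w + th)) =
    \int[P]_w (1 * cos (t * Z w + th)) + \sum_(p : I * I) x p.1 * x p.2 *
      \int[P]_w (e p.1 w * e p.2 w * cos (t * Z w + th)).
  rewrite (eq_bigr (fun p => \int[P]_w (x p.1 * x p.2 *
    (e p.1 w * e p.2 w * cos (t * Z w + th))))); last first.
    by move=> p _; rewrite RintegralZl//; exact: Ic2.
  rewrite -(Rintegral_sum (P := P)); last by move=> p _; exact: intbleZ.
  rewrite -RintegralD//; last by apply: intble_sum => p _; exact: intbleZ.
  apply: eq_Rintegral => w _; rewrite mulrDl sum_sqrE; congr (_ + _).
  by rewrite mulr_suml; apply: eq_bigr => p _; ring.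
apply: (le_trans (ler_normD _ _)).
have h1 : `|\int[P]_w (1 * cos (t * Z w + th))| <= 2 * E.
  apply: (le_trans (Rintegral_shift_cos_le _ (intble_cst P 1) (mtZ t))).
  by rewrite ler_pM2l//; exact: charf_sum_le.
suff h2 : `|\sum_(p : I * I) x p.1 * x p.2 *
      \int[P]_w (e p.1 w * e p.2 w * cos (t * Z w + th))| <= 2 * ((2 + 4 * t ^+ 2) * E).
  by apply: (le_trans (lerD h1 h2)); lra.
apply: (le_trans (ler_norm_sum _ _ _)).
apply: (@le_trans _ _ (\sum_(p : I * I) 2 *
   (((p.1 == p.2)%:R * 2 * x p.1 ^+ 2 + 4 * t ^+ 2 * (x p.1 ^+ 2 * x p.2 ^+ 2)) * E))).
  apply: ler_sum => p _; rewrite normrM.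
  apply: (le_trans (ler_wpM2l (normr_ge0 _)
    (Rintegral_shift_cos_le th (intble_cross p.1 p.2) (mtZ t)))).
  by rewrite mulrCA ler_pM2l//; exact: cross_moment_le.
rewrite -mulr_sumr ler_pM2l// -mulr_suml ler_wpM2r ?expR_ge0// big_split /= lerD//.
  rewrite -(pair_bigA _ (fun i j => (i == j)%:R * 2 * x i ^+ 2)) /=.
  rewrite -[leRHS]mulr1 -[X in _ <= _ * X]x1 mulr_sumr; apply: ler_sum => i _.
  rewrite (bigD1 i)//= eqxx big1 ?addr0.
    by rewrite (_ : true%:R = 1 :> R)// mul1r.
  move=> j ji.
  by rewrite eq_sym (negbTE ji) !mul0r.
rewrite -mulr_sumr ler_piMr//; first by rewrite mulr_ge0// sqr_ge0.
rewrite -(pair_bigA _ (fun i j => x i ^+ 2 * x j ^+ 2)) /=.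
by under eq_bigr do rewrite -mulr_sumr x1 mulr1; rewrite x1.
Qed.

(** Telescoping in the manner of Lindeberg: factors are exchanged one at a time and the remaining
    ones are replaced by the common majorant. *)
Lemma normc_prodB_le (J : eqType) (r : seq J) (A B : J -> R[i]) (M : J -> R) :
  uniq r -> (forall i, normc (A i) <= M i) -> (forall i, normc (B i) <= M i) ->
  normc (\prod_(i <- r) A i - \prod_(i <- r) B i) <=
  \sum_(l <- r) normc (A l - B l) * \prod_(i <- r | i != l) M i.
Proof.
move=> + hA hB; have M0 i : 0 <= M i by exact: le_trans (normc_ge0 _) (hA i).
elim: r => [_|j s IH /= /andP[js us]]; first by rewrite !big_nil subrr Normc.normc0.
rewrite !big_cons (_ : _ - _ = (A j - B j) * \prod_(i <- s) A i +
    B j * (\prod_(i <- s) A i - \prod_(i <- s) B i)); last by ring.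
apply: (le_trans (le_normcD _ _)); rewrite !Normc.normcM eqxx /=; apply: lerD.
  apply: ler_wpM2l; first exact: normc_ge0.
  rewrite normc_prod [leRHS](_ : _ = \prod_(i <- s) M i).
    by apply: ler_prod => i _; rewrite normc_ge0 hA.
  rewrite big_seq_cond [RHS]big_seq; apply: eq_bigl => i.
  by case: (boolP (i \in s)) => //= si; apply: contraNneq js => <-.
apply: (le_trans (ler_pM (normc_ge0 _) (normc_ge0 _) (hB j) (IH us))).
rewrite mulr_sumr [leLHS]big_seq [leRHS]big_seq; apply: ler_sum => l ls.
rewrite big_cons ifT; first by rewrite mulrCA.
by apply: contraNneq js => ->.
Qed.

Lemma charf_prod_gauss t j : 0 <= t -> 32 * rho * eps * t <= 1 ->
  normc (\prod_(l | l != j) mcharf 0 (e l) (t * x l) - (expR (- (t ^+ 2 / 2)))%:C)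
  <= ((t * x j) ^+ 2 / 2 + 3 * rho * t ^+ 3 * eps) * expR (- (t ^+ 2 / 8)).
Proof.
move=> t0 ht; set Pj := \prod_(l | l != j) _; set E := expR (- (t ^+ 2 / 8)).
have r0 : 0 <= rho := le_trans ler01 rho1.
pose g l : R := expR (- ((t * x l) ^+ 2 / 2)).
have hexcl l : \sum_(i | ~~ (i != l)) x i ^+ 2 <= 1 / 4.
  rewrite (eq_bigl (fun i => i == l)); last by move=> i; rewrite negbK.
  by rewrite big_pred1_eq; have := sqr_coord_le l; lra.
have hP : normc Pj <= E by exact: (@charf_prod_le t (fun l => l != j)).
have gE : (expR (- (t ^+ 2 / 2)))%:C = \prod_l (g l)%:C.
  rewrite -rmorph_prod -expR_sum; congr (expR _)%:C.
  rewrite sumrN -mulr_suml; congr (- (_ / 2)).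
  by under eq_bigr do rewrite exprMn; rewrite -mulr_sumr x1 mulr1.
(* The missing coordinate j receives its Gaussian factor, so that both products run over all of [I]
   and the telescoping term at j vanishes; the price 1 - g j is at most (t x_j)^2 / 2. *)
pose A l := if l == j then (g l)%:C else mcharf 0 (e l) (t * x l).
have AE : \prod_l A l = Pj * (g j)%:C.
  rewrite (bigD1 j)//= /A eqxx mulrC; congr (_ * _).
  by apply: eq_bigr => l /negbTE->.
have gd l : normc (g l)%:C <= damp rho (t * x l).
  by rewrite normc_real ger0_norm ?expR_ge0// gauss_le_damp.
have cd l : normc (mcharf 0 (e l) (t * x l)) <= damp rho (t * x l).
  by rewrite mcharf0; exact: charf_norm_damp.
rewrite gE (_ : _ - _ = Pj * (1 - g j)%:C + (\prod_l A l - \prod_l (g l)%:C)); last first.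
  by rewrite AE rmorphB /= rmorph1; ring.
apply: (le_trans (le_normcD _ _)); rewrite mulrDl; apply: lerD.
  rewrite Normc.normcM normc_real mulrC ler_pM ?normc_ge0//.
  have := expR_ge1Dx (- ((t * x j) ^+ 2 / 2)); rewrite -/(g j) => h.
  have : g j <= 1 by rewrite expR_le1 oppr_le0 divr_ge0// sqr_ge0.
  by move=> h'; rewrite ger0_norm; lra.
apply: (le_trans (@normc_prodB_le _ _ _ _ (fun l => damp rho (t * x l)) _ _ _)) => //.
- exact: index_enum_uniq.
- by move=> l; rewrite /A; case: eqP => // _; exact: gd.
apply: (@le_trans _ _ (\sum_l (3 * rho * `|t * x l| ^+ 3) * E)); last first.
  rewrite -mulr_suml ler_wpM2r ?expR_ge0// /eps mulr_sumr.
  apply: ler_sum => l _; rewrite normrM (ger0_norm t0) exprMn.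
  by rewrite le_eqVlt; apply/orP; left; apply/eqP; ring.
apply: ler_sum => l _; apply: ler_pM; rewrite ?normc_ge0//.
- by apply: prodr_ge0 => i _; exact: expR_ge0.
- rewrite /A; case: eqP => [->|_]; last by rewrite mcharf0; exact: charf_gauss.
  by rewrite subrr Normc.normc0 !mulr_ge0 ?exprn_ge0.
- exact: damp_prod.
Qed.

(** In E[e_j e^(i t Z)] the factor of e_j is i t x_j up to 2 rho (t x_j)^2, and the other factors
    multiply to nearly exp(- t^2 / 2). Weighting by x_j and using that the x_j^2 sum to 1 leaves t
    exp(- t^2 / 2). *)
Lemma Rintegral_sum_sin_approx t : 0 <= t -> 32 * rho * eps * t <= 1 ->
  `|\int[P]_w (Z w * sin (t * Z w)) - t * expR (- (t ^+ 2 / 2))| <=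
  rho * eps * (2 * t ^+ 2 + t ^+ 3 + 3 * t ^+ 4) * expR (- (t ^+ 2 / 8)).
Proof.
move=> t0 ht; set E := expR (- (t ^+ 2 / 8)); set G := expR _.
have r0 : 0 <= rho := le_trans ler01 rho1.
have eps0 : 0 <= eps by apply: sumr_ge0 => i _; exact: exprn_ge0.
have Is j : intble P (fun w => e j w * sin (t * Z w)).
  by apply: intbleM_sin; [exact: sm_int1 (He j)|].
pose W j := cexpectation P (fun w => (e j w)%:C * cis (t * Z w)).
have ImW j : Im (W j) = \int[P]_w (e j w * sin (t * Z w)).
  by apply: eq_Rintegral => w _ /=; ring.
have WE j : W j = mcharf 1 (e j) (t * x j) * \prod_(l | l != j) mcharf 0 (e l) (t * x l).
  have n2 l : (nat_of_bool (l == j) <= 2)%N by case: (l == j).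
  have := @moment_charf (fun l => nat_of_bool (l == j)) t n2.
  rewrite (_ : (fun w => _) = fun w => (e j w)%:C * cis (t * Z w)); last first.
    apply/funext => w; congr (_%:C * _).
    by rewrite (bigD1 j)//= eqxx expr1 big1 ?mulr1// => l /negbTE->.
  rewrite /W => ->; rewrite (bigD1 j)//= eqxx; congr (_ * _).
  by apply: eq_bigr => l /negbTE->.
have key j : `|Im (W j) - t * x j * G| <=
    (2 * rho * (t * x j) ^+ 2 +
     `|t * x j| * ((t * x j) ^+ 2 / 2 + 3 * rho * t ^+ 3 * eps)) * E.
  set u := t * x j.
  apply: (@le_trans _ _ (normc (W j - (0 +i* u) * G%:C))).
    apply: le_trans ((normc_ge_ReIm _).2).
    rewrite le_eqVlt; apply/orP; left; apply/eqP; congr (`|_|).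
    by case: (W j) => a b /=; ring.
  rewrite WE -/u; set Pj := \prod_(l | l != j) _.
  rewrite (_ : _ - _ = (mcharf 1 (e j) u - (0 +i* u)) * Pj + (0 +i* u) * (Pj - G%:C)); last by ring.
  apply: (le_trans (le_normcD _ _)); rewrite !Normc.normcM mulrDl; apply: lerD.
    apply: ler_pM; rewrite ?normc_ge0//; first exact: mcharf1_approx.
    apply: (@charf_prod_le t (fun l => l != j)) => //.
    rewrite (eq_bigl (fun i => i == j)); last by move=> i; rewrite negbK.
    by rewrite big_pred1_eq; have := sqr_coord_le j; lra.
  rewrite -[leRHS]mulrA; apply: ler_pM; rewrite ?normc_ge0//.
    by rewrite /= expr0n /= add0r sqrtr_sqr.
  exact: charf_prod_gauss.
have -> : \int[P]_w (Z w * sin (t * Z w)) = \sum_j x j * Im (W j).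
  rewrite [RHS](eq_bigr (fun j => \int[P]_w (x j * (e j w * sin (t * Z w))))); last first.
    by move=> j _; rewrite ImW RintegralZl//; exact: Is.
  rewrite -(Rintegral_sum (P := P)); last by move=> j _; exact: intbleZ.
  apply: eq_Rintegral => w _; rewrite {1}/Z mulr_suml.
  by apply: eq_bigr => j _; rewrite mulrA.
have -> : t * G = \sum_j x j * (t * x j * G).
  rewrite -[t in LHS]mulr1 -[X in t * X]x1 mulr_sumr mulr_suml.
  by apply: eq_bigr => j _; ring.
rewrite -sumrB; apply: (le_trans (ler_norm_sum _ _ _)).
apply: (@le_trans _ _ (\sum_j (rho * (2 * t ^+ 2 + t ^+ 3) * `|x j| ^+ 3 +
   3 * rho * t ^+ 4 * eps * x j ^+ 2) * E)).
  apply: ler_sum => j _; rewrite -mulrBr normrM.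
  apply: (le_trans (ler_wpM2l (normr_ge0 _) (key j))).
  rewrite mulrA ler_wpM2r ?expR_ge0// normrM (ger0_norm t0).
  have xj := sqr_coord_le j; move: xj; rewrite exprMn -[x j ^+ 2]real_normK ?num_real//.
  have := normr_ge0 (x j); set a := `|x j| => a0 a2.
  have a1 : a <= 1 by clear key; nra.
  have a3 : 0 <= a ^+ 3 by exact: exprn_ge0.
  have t3 : 0 <= t ^+ 3 by exact: exprn_ge0.
  have -> : a * (2 * rho * (t ^+ 2 * a ^+ 2) +
      t * a * (t ^+ 2 * a ^+ 2 / 2 + 3 * rho * t ^+ 3 * eps)) =
     rho * (2 * t ^+ 2) * a ^+ 3 + t ^+ 3 * a ^+ 3 * (a / 2) + 3 * rho * t ^+ 4 * eps * a ^+ 2 by field.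
  rewrite lerD2r mulrDr mulrDl lerD2l.
  have -> : rho * t ^+ 3 * a ^+ 3 = t ^+ 3 * a ^+ 3 * rho by ring.
  apply: ler_wpM2l; first exact: mulr_ge0.
  by apply: (le_trans _ rho1); lra.
rewrite -mulr_suml ler_wpM2r ?expR_ge0// big_split /= -!mulr_sumr x1 -/eps.
by rewrite le_eqVlt; apply/orP; left; apply/eqP; ring.
Qed.

Lemma sqr_mul_expRN_le (t : R) : t ^+ 4 * expR (- (t ^+ 2 / 8)) <= 128.
Proof.
have := expR_ge1Dxn 1 (divr_ge0 (sqr_ge0 t) (ler0n _ 8)).
rewrite expRN ler_pdivrMr ?expR_gt0//; set F := expR _.
have -> : (t ^+ 2 / 8%:R) ^+ 2 / 2`!%:R = t ^+ 4 / 128 by rewrite -[2`!]/2%N; field.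
lra.
Qed.

Lemma cube_mul_expRN_le (t : R) : t ^+ 6 * expR (- (t ^+ 2 / 8)) <= 3072.
Proof.
have := expR_ge1Dxn 2 (divr_ge0 (sqr_ge0 t) (ler0n _ 8)).
rewrite expRN ler_pdivrMr ?expR_gt0//; set F := expR _.
have -> : (t ^+ 2 / 8%:R) ^+ 3 / 3`!%:R = t ^+ 6 / 3072 by rewrite -[3`!]/6%N; field.
lra.
Qed.

(** The Gaussian decay is spent on a factor 1 / t, which together with the Fourier coefficient 2 / t
    makes the errors summable over the frequencies. The constant is 6 (1 + 3072) = 18438, rounded
    up. *)
Lemma sum_sin_approx t : 0 < t -> 32 * rho * eps * t <= 1 ->
  `|\int[P]_w (Z w * sin (t * Z w)) - t * expR (- (t ^+ 2 / 2))| <=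
  20000 * rho * eps / t.
Proof.
move=> t0 ht; apply: (le_trans (Rintegral_sum_sin_approx (ltW t0) ht)).
have r0 : 0 <= rho := le_trans ler01 rho1.
have eps0 : 0 <= eps by apply: sumr_ge0 => i _; exact: exprn_ge0.
rewrite ler_pdivlMr//; set E := expR _.
have -> : rho * eps * (2 * t ^+ 2 + t ^+ 3 + 3 * t ^+ 4) * E * t =
  rho * eps * ((2 * t ^+ 3 + t ^+ 4 + 3 * t ^+ 5) * E) by ring.
rewrite (_ : 20000 * rho * eps = rho * eps * 20000); last by ring.
apply: ler_wpM2l; first exact: mulr_ge0.
have E0 : 0 <= E by exact: expR_ge0.
have E1 : E <= 1 by rewrite expR_le1 oppr_le0 divr_ge0// sqr_ge0.
have h6 := cube_mul_expRN_le t; rewrite -/E in h6.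
have h : 2 * t ^+ 3 + t ^+ 4 + 3 * t ^+ 5 <= 6 * (1 + t ^+ 6).
  have [t1|t1] := leP t 1.
    have p n : t ^+ n <= 1 by apply: exprn_ile1 => //; exact: ltW.
    have := p 3%N; have := p 4%N; have := p 5%N; have : 0 <= t ^+ 6 by exact/exprn_ge0/ltW.
    lra.
  have p n : (n <= 6)%N -> t ^+ n <= t ^+ 6 by move=> ?; rewrite ler_eXn2l.
  have := p 3%N isT; have := p 4%N isT; have := p 5%N isT; lra.
apply: (le_trans (ler_wpM2r E0 h)); lra.
Qed.

Lemma sum_sqr_cos_le t th : 0 < t -> 32 * rho * eps * t <= 1 ->
  `|\int[P]_w ((1 + Z w ^+ 2) * cos (t * Z w + th))| <= 2000 / t ^+ 2.
Proof.
move=> t0 ht; apply: (le_trans (Rintegral_sum_sqr_cos_le th (ltW t0) ht)).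
rewrite ler_pdivlMr ?exprn_gt0//; set E := expR _.
have E0 : 0 <= E by exact: expR_ge0.
have E1 : E <= 1 by rewrite expR_le1 oppr_le0 divr_ge0// sqr_ge0.
have h4 := sqr_mul_expRN_le t; rewrite -/E in h4.
have h : (6 + 8 * t ^+ 2) * t ^+ 2 <= 3 + 11 * t ^+ 4.
  rewrite (_ : t ^+ 4 = t ^+ 2 * t ^+ 2); last by ring.
  by have := sqr_ge0 (t ^+ 2 - 1); nra.
rewrite mulrAC; apply: (le_trans (ler_wpM2r E0 h)); lra.
Qed.

(** * The quantization error of one row *)

Section sampled_row.
Variables (M1 delta : R) (N : nat).
Hypothesis M1_gt0 : 0 < M1.
(* The conclusion of quantizer_error_approx. *)
Hypothesis approx : forall delta z (N : nat) (y := pi - 2 * pi * (z / delta)),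
  0 < delta -> (0 < N)%N ->
  `|2 * pi / delta * (z - quantizer delta z) - sin_poly N y| <=
  M1 / N%:R ^+ 2 * fejer2 N y.
Hypothesis delta_gt0 : 0 < delta.
Hypothesis N_gt0 : (0 < N)%N.
Hypothesis N_small : 32 * rho * eps * (2 * pi / delta * N%:R) <= 1.

Let freq : R := 2 * pi / delta.
Let y w : R := pi - 2 * pi * (Z w / delta).

Let freq0 : 0 < freq.
Proof. by rewrite /freq divr_gt0// mulr_gt0// pi_gt0. Qed.

Let rho0 : 0 <= rho := le_trans ler01 rho1.

Let eps0 : 0 <= eps.
Proof. by apply: sumr_ge0 => i _; exact: exprn_ge0. Qed.

Let freq_small (a : R) : 0 <= a <= N%:R -> 32 * rho * eps * (freq * a) <= 1.
Proof.
move=> /andP[a0 aN]; apply: le_trans N_small; apply: ler_wpM2l.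
  by rewrite !mulr_ge0.
by rewrite -/freq ler_pM2l.
Qed.

Let inv_freq_sqr : 1 / freq ^+ 2 <= delta ^+ 2 / 16.
Proof.
have d2 : 0 < delta ^+ 2 by exact: exprn_gt0.
rewrite /freq; move: (pi_ge2 R); move: (@pi R) => p p2.
have p0 : 0 < p by lra.
rewrite (_ : 1 / _ = delta ^+ 2 / (2 * p) ^+ 2); last first.
  by field; rewrite !gt_eqF.
rewrite ler_pM2l// lef_pV2 ?posrE ?exprn_gt0 ?mulr_gt0//.
nra.
Qed.

Let intble_sqr_cos (g : T -> R) : measurable_fun setT g ->
  intble P (fun w => (1 + Z w ^+ 2) * cos (g w)).
Proof.
by apply: intbleM_cos; apply: intbleD; [exact: intble_cst|exact: intble_sum_sqr].
Qed.

Let my : measurable_fun setT y.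
Proof.
apply: measurable_funB => //; apply: measurable_funM => //.
by apply: measurable_funM.
Qed.

Let m_affine (a b : R) : measurable_fun setT (fun w => a * (y w + b)).
Proof. by apply: measurable_funM => //; exact: measurable_funD. Qed.

(** As a function of [Z] this cosine has frequency [freq] |kappa| and some phase; 125 is 2000 /
    16. *)
Lemma sampled_cos_le (kappa eta : R) : 0 < `|kappa| <= N%:R ->
  `|\int[P]_w ((1 + Z w ^+ 2) * cos (kappa * (y w + eta)))| <=
  125 * delta ^+ 2 * (kappa ^+ 2)^-1.
Proof.
move=> /andP[k0 kN].
have t0 : 0 < freq * `|kappa| by rewrite mulr_gt0.
have ht : 32 * rho * eps * (freq * `|kappa|) <= 1.
  by apply: freq_small; rewrite ltW.
have final : 2000 / (freq * `|kappa|) ^+ 2 <= 125 * delta ^+ 2 * (kappa ^+ 2)^-1.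
  rewrite exprMn real_normK ?num_real// invfM mulrA ler_wpM2r ?invr_ge0 ?sqr_ge0//.
  have := inv_freq_sqr; rewrite mul1r; lra.
apply: le_trans final; have [kpos|kneg] := leP 0 kappa.
  have cE w : cos (kappa * (y w + eta)) = cos (freq * `|kappa| * Z w + - (kappa * (pi + eta))).
    rewrite -cosN (ger0_norm kpos); congr cos; rewrite /y /freq.
    by field; rewrite gt_eqF.
  under eq_Rintegral do rewrite cE; exact: sum_sqr_cos_le.
have cE w : cos (kappa * (y w + eta)) = cos (freq * `|kappa| * Z w + kappa * (pi + eta)).
  rewrite (ltr0_norm kneg); congr cos; rewrite /y /freq.
  by field; rewrite gt_eqF.
under eq_Rintegral do rewrite cE; exact: sum_sqr_cos_le.
Qed.

Lemma sampled_cos0_le eta :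
  `|\int[P]_w ((1 + Z w ^+ 2) * cos (0 * (y w + eta)))| <= 6.
Proof.
have h0 : 32 * rho * eps * 0 <= 1 by rewrite mulr0.
have := Rintegral_sum_sqr_cos_le 0 (lexx 0) h0.
rewrite expr0n /= mul0r oppr0 expR0 mulr0 addr0 mulr1.
by congr (`|_| <= _); apply: eq_Rintegral => w _; rewrite !mul0r addr0.
Qed.

Lemma intble_fejer eta : intble P (fun w => (1 + Z w ^+ 2) * fejer N (y w + eta)).
Proof.
under eq_fun do rewrite fejer_double_sum mulr_sumr.
by apply: intble_sum => p _; exact: intble_sqr_cos.
Qed.

Lemma sampled_fejer_le eta :
  \int[P]_w ((1 + Z w ^+ 2) * fejer N (y w + eta)) <= N%:R * (6 + 500 * delta ^+ 2).
Proof.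
under eq_Rintegral do rewrite fejer_double_sum mulr_sumr.
rewrite Rintegral_sum; last by move=> p _; exact: intble_sqr_cos.
apply: (@le_trans _ _ (\sum_(p : 'I_N * 'I_N) ((p.1 == p.2)%:R * 6 +
   (p.2 != p.1)%:R * (125 * delta ^+ 2 * ((p.1%:R - p.2%:R) ^+ 2)^-1)))).
  apply: ler_sum => -[i j] _ /=; apply: (le_trans (ler_norm _)).
  have [<-|ij] := eqVneq i j.
    rewrite /= mul0r addr0 mul1r subrr; exact: sampled_cos0_le.
  rewrite /= mul0r add0r mul1r; apply: sampled_cos_le.
  have d0 : (i%:R - j%:R : R) != 0 by rewrite subr_eq0 eqr_nat.
  rewrite normr_gt0 d0 /= ler_norml.
  have := ltn_ord i; have := ltn_ord j; rewrite -!(ltr_nat R).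
  have : 0 <= i%:R :> R by []; have : 0 <= j%:R :> R by [].
  by move=> *; apply/andP; split; lra.
rewrite -(pair_bigA _ (fun i j : 'I_N => (i == j)%:R * 6 +
   (j != i)%:R * (125 * delta ^+ 2 * ((i%:R - j%:R) ^+ 2)^-1))) /=.
apply: (@le_trans _ _ (\sum_(i < N) (6 + 500 * delta ^+ 2))); last first.
  by rewrite sumr_const card_ord -[X in X <= _]mulr_natl.
apply: ler_sum => i _; rewrite big_split /=; apply: lerD.
  rewrite (bigD1 i)//= eqxx mul1r big1 ?addr0// => j ji.
  by rewrite eq_sym (negbTE ji) mul0r.
rewrite (_ : 500 * delta ^+ 2 = 125 * delta ^+ 2 * 4); last by ring.
apply: (@le_trans _ _ (125 * delta ^+ 2 *
    \sum_(l < N | l != i) ((i%:R - l%:R) ^+ 2)^-1)).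
  rewrite mulr_sumr [leRHS]big_mkcond /=; apply: ler_sum => j _.
  by case: ifP; rewrite ?mul1r ?mul0r.
apply: ler_wpM2l; first by rewrite mulr_ge0// sqr_ge0.
exact: sum_inv_sqr_dist_le.
Qed.

Lemma sin_natr_pi_sub (k : nat) (u : R) : sin (k.+1%:R * pi - u) = (-1) ^+ k * sin u.
Proof.
elim: k => [|k IH].
  by rewrite expr0 !mul1r sinB sinpi cospi mul0r mulN1r sub0r opprK.
rewrite -[k.+2%:R]natr1 mulrDl mul1r addrAC sinDpi IH exprS; ring.
Qed.

Let t k : R := freq * k.+1%:R.
Let coef k : R := (-1) ^+ k * cutoff N k.+1%:R * (2 / t k).

Let t0 k : 0 < t k. Proof. by rewrite mulr_gt0. Qed.

Lemma sampled_sin_polyE w :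
  delta / (2 * pi) * (Z w * sin_poly N (y w)) = \sum_(k < N) coef k * (Z w * sin (t k * Z w)).
Proof.
rewrite /sin_poly !mulr_sumr; apply: eq_bigr => k _.
have -> : k.+1%:R * y w = k.+1%:R * pi - t k * Z w.
  by rewrite /y /t /freq; field; rewrite gt_eqF.
rewrite sin_natr_pi_sub /coef /t /freq.
move: (sin _) => S; move: (pi_gt0 R); move: (@pi R) => p p0; field.
by rewrite !gt_eqF.
Qed.

Lemma intble_sum1 : intble P Z.
Proof. by apply: intble_sum => i _; apply: intbleZ; exact: sm_int1 (He i). Qed.

Let intble_Zsin k : intble P (fun w => Z w * sin (t k * Z w)).
Proof. by apply: intbleM_sin; [exact: intble_sum1|exact: mtZ]. Qed.

Lemma intble_quantization_error : intble P (fun w => Z w * (Z w - quantizer delta (Z w))).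
Proof.
apply: (@intbleMb _ _ _ _ _ _ (delta / 2)); first exact: intble_sum1.
  apply: measurable_funB => //.
  by apply: measurableT_comp => //; exact: measurable_quantizer.
by move=> w; exact: quantizer_error_le.
Qed.

Lemma Rintegral_error_lower :
  \sum_(k < N) coef k * \int[P]_w (Z w * sin (t k * Z w)) -
    delta / (2 * pi) * (M1 / N%:R ^+ 2) * (N%:R * (6 + 500 * delta ^+ 2))
  <= \int[P]_w (Z w * (Z w - quantizer delta (Z w))).
Proof.
pose B w := delta / (2 * pi) * (M1 / N%:R ^+ 2) * (2^-1 * ((1 + Z w ^+ 2) * fejer2 N (y w))).
have fejE w : (1 + Z w ^+ 2) * fejer2 N (y w) =
    (1 + Z w ^+ 2) * fejer N (y w + 0) + (1 + Z w ^+ 2) * fejer N (y w + pi / N%:R).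
  by rewrite addr0 -mulrDr.
have If : intble P (fun w => (1 + Z w ^+ 2) * fejer2 N (y w)).
  by under eq_fun do rewrite fejE; apply: intbleD; exact: intble_fejer.
have IB : intble P B by do 2 apply: intbleZ.
have c0 : 0 <= delta / (2 * pi) * (M1 / N%:R ^+ 2).
  by rewrite mulr_ge0// divr_ge0 ?sqr_ge0 ?mulr_ge0 ?pi_ge0// ltW.
have EB : \int[P]_w B w <= delta / (2 * pi) * (M1 / N%:R ^+ 2) * (N%:R * (6 + 500 * delta ^+ 2)).
  rewrite /B RintegralZl//; last exact: intbleZ.
  apply: ler_wpM2l => //; rewrite RintegralZl//.
  under eq_Rintegral do rewrite fejE.
  rewrite RintegralD//; [|exact: intble_fejer|exact: intble_fejer].
  have := sampled_fejer_le 0; have := sampled_fejer_le (pi / N%:R); lra.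
have IS : intble P (fun w => \sum_(k < N) coef k * (Z w * sin (t k * Z w))).
  by apply: intble_sum => k _; exact: intbleZ.
have -> : \sum_(k < N) coef k * \int[P]_w (Z w * sin (t k * Z w)) =
    \int[P]_w (\sum_(k < N) coef k * (Z w * sin (t k * Z w))).
  rewrite Rintegral_sum; last by move=> k _; exact: intbleZ.
  by apply: eq_bigr => k _; rewrite RintegralZl//; exact: intble_Zsin.
apply: (le_trans (lerB (lexx _) EB)).
rewrite -RintegralB//; apply: le_Rintegral => //.
- exact: intbleB.
- exact: intble_quantization_error.
move=> w _; rewrite -sampled_sin_polyE /B.
have := approx (Z w) delta_gt0 N_gt0; rewrite -/(y w) -/freq.
set q := Z w - quantizer _ _; set S := sin_poly _ _; set F := fejer2 _ _ => h.
have F0 : 0 <= F by rewrite addr_ge0// fejer_ge0.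
have -> : Z w * q = delta / (2 * pi) * (Z w * (freq * q)).
  rewrite /freq; move: (pi_gt0 R); move: (@pi R) => p p0.
  by field; rewrite !gt_eqF.
rewrite -[X in _ - X]mulrA -mulrBr ler_wpM2l//.
  by rewrite divr_ge0 ?mulr_ge0 ?pi_ge0// ltW.
rewrite lerBlDl -lerBlDr -mulrBr.
have zq : Z w * (S - freq * q) <= `|Z w| * `|freq * q - S|.
  by rewrite -[`|_ - S|]normrN opprB -normrM ler_norm.
apply: (le_trans zq); apply: (le_trans (ler_wpM2l (normr_ge0 _) h)).
rewrite mulrCA ler_wpM2l ?divr_ge0 ?sqr_ge0 ?(ltW M1_gt0)//.
rewrite mulrA ler_wpM2r//.
have := sqr_ge0 (`|Z w| - 1); rewrite -[Z w ^+ 2]real_normK ?num_real//; nra.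
Qed.

Let G k : R := expR (- (t k ^+ 2 / 2)).

Lemma cutoff_antitone k : (k.+1 <= N)%N -> cutoff N k.+1%:R <= cutoff N k%:R :> R.
Proof.
move=> kN; have kk : k%:R <= k.+1%:R :> R by rewrite ler_nat.
have k1 : k.+1%:R / N%:R <= 1 :> R by rewrite ler_pdivrMr ?ltr0n// mul1r ler_nat.
have k0 : 0 <= k%:R / N%:R :> R by rewrite divr_ge0.
have k2 : k%:R / N%:R <= k.+1%:R / N%:R :> R by rewrite ler_wpM2r// invr_ge0.
rewrite /cutoff lerXn2r ?nnegrE//; nra.
Qed.

Lemma alternating_gauss_ge :
  2 * (expR (- (2 * pi ^+ 2 / delta ^+ 2)) - expR (- (8 * pi ^+ 2 / delta ^+ 2))) -
    6 / N%:R ^+ 2 * expR (- (2 * pi ^+ 2 / delta ^+ 2))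
  <= \sum_(k < N) coef k * (t k * G k).
Proof.
pose g k := (if (k < N)%N then cutoff N k.+1%:R else 0) * G k.
have G_ge0 k : 0 <= G k by exact: expR_ge0.
have cut01 k : (k < N)%N -> 0 <= (cutoff N k.+1%:R : R) <= 1 by exact: cutoff_ge0_le1.
have g_ge0 k : 0 <= g k.
  by rewrite /g; case: ifP => [/cut01/andP[c0 _]|_]; rewrite ?mul0r// mulr_ge0.
have g_anti k : (k.+1 < N)%N -> g k.+1 <= g k.
  move=> kN; have kN' := ltnW kN; rewrite /g kN kN'; apply: ler_pM => //.
  - by have /andP[] := cut01 _ kN.
  - exact: cutoff_antitone.
  rewrite ler_expR lerN2 ler_pM2r// lerXn2r ?nnegrE ?(ltW (t0 _))//.
  by rewrite ler_pM2l// ler_nat.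
have -> : \sum_(k < N) coef k * (t k * G k) = 2 * \sum_(k < N) (-1) ^+ k * g k.
  rewrite mulr_sumr; apply: eq_bigr => k _; rewrite /g ltn_ord /coef.
  by have := t0 k; move: (t k) => s s0; field; rewrite gt_eqF.
have := alternating_sum_ge N_gt0 g_ge0 g_anti.
have E0 : G 0 = expR (- (2 * pi ^+ 2 / delta ^+ 2)).
  by congr expR; rewrite /t /freq; field; rewrite gt_eqF.
have E1 : G 1 = expR (- (8 * pi ^+ 2 / delta ^+ 2)).
  by congr expR; rewrite /t /freq; field; rewrite gt_eqF.
have g1 : g 1%N <= G 1.
  rewrite /g; case: ifP => [/cut01/andP[_ c1]|_]; last by rewrite mul0r.
  by rewrite ler_piMl.
have g0 : (1 - 3 / N%:R ^+ 2) * G 0 <= g 0%N.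
  rewrite /g N_gt0 ler_wpM2r// /cutoff.
  have v0 : 0 < (N%:R^-1 : R) by rewrite invr_gt0 ltr0n.
  have v1 : (N%:R^-1 : R) <= 1 by rewrite invf_le1 ?ltr0n// ler1n.
  rewrite -[N%:R ^- 2]exprVn mul1r; set v : R := N%:R^-1 in v0 v1 *.
  have u0 : 0 <= v ^+ 2 <= 1 by rewrite sqr_ge0 exprn_ile1// ltW.
  set u := v ^+ 2 in u0 *; case/andP: u0 => u0 u1.
  have := sqr_ge0 u; rewrite -subr_ge0 => u2.
  rewrite (_ : (1 - u) ^+ 3 = 1 - 3 * u + (u * u) * (3 - u)); last by ring.
  have : 0 <= u * u * (3 - u) by rewrite !mulr_ge0//; lra.
  lra.
rewrite -E0 -E1 => h; lra.
Qed.

Lemma row_lower_bound :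
  2 * (expR (- (2 * pi ^+ 2 / delta ^+ 2)) - expR (- (8 * pi ^+ 2 / delta ^+ 2))) -
    6 / N%:R ^+ 2 * expR (- (2 * pi ^+ 2 / delta ^+ 2)) -
    5000 * rho * eps * delta ^+ 2 -
    delta / (2 * pi) * (M1 / N%:R ^+ 2) * (N%:R * (6 + 500 * delta ^+ 2))
  <= \int[P]_w (Z w * (Z w - quantizer delta (Z w))).
Proof.
apply: le_trans Rintegral_error_lower; rewrite lerD2r.
apply: (le_trans (lerB alternating_gauss_ge (lexx _))).
rewrite lerBlDl -lerBlDr -sumrB.
apply: (@le_trans _ _ (\sum_(k < N) 2 * 20000 * rho * eps / freq ^+ 2 * (k.+1%:R ^+ 2)^-1)).
  apply: ler_sum => k _; rewrite -mulrBr; apply: (le_trans (ler_norm _)).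
  rewrite normrM distrC.
  have tk := t0 k; have hk : 32 * rho * eps * t k <= 1.
    by apply: freq_small; rewrite ler0n ler_nat ltn_ord.
  have h1 : `|coef k| <= 2 / t k.
    rewrite /coef normrM [`|_ * cutoff _ _|]normrM normrX normrN1 expr1n mul1r (@ger0_norm _ (2 / t k)); last first.
      by rewrite divr_ge0// ltW.
    have /andP[c0 c1] := @cutoff_ge0_le1 R N N_gt0 k.+1 (ltn_ord k).
    by rewrite ger0_norm// ler_piMl// divr_ge0// ltW.
  apply: (le_trans (ler_pM (normr_ge0 _) (normr_ge0 _) h1 (sum_sin_approx tk hk))).
  rewrite le_eqVlt; apply/orP; left; apply/eqP; rewrite /t.
  have k0 : 0 < k.+1%:R :> R by [].
  move: (k.+1%:R : R) k0 (freq) freq0 => s s0 f f0; field.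
  by rewrite !gt_eqF.
rewrite -mulr_sumr.
have re0 : 0 <= rho * eps by exact: mulr_ge0.
have c0 : 0 <= 2 * 20000 * rho * eps / freq ^+ 2.
  rewrite (_ : _ / _ = rho * eps * (freq ^+ 2)^-1 * (2 * 20000)); last by ring.
  apply: mulr_ge0; last by lra.
  by apply: mulr_ge0 => //; rewrite invr_ge0 sqr_ge0.
apply: (le_trans (ler_wpM2l c0 (sum_inv_sqr_le R N))).
have := ler_wpM2l re0 inv_freq_sqr; rewrite mul1r.
rewrite (_ : 2 * 20000 * rho * eps / freq ^+ 2 * 2 = 4 * 20000 * (rho * eps * (freq ^+ 2)^-1)); last by ring.
lra.
Qed.

End sampled_row.

Lemma quantization_bias_lower (M1 delta : R) : 0 < M1 ->
  (forall delta z (N : nat) (y := pi - 2 * pi * (z / delta)),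
    0 < delta -> (0 < N)%N ->
    `|2 * pi / delta * (z - quantizer delta z) - sin_poly N y| <=
    M1 / N%:R ^+ 2 * fejer2 N y) ->
  0 < delta -> 256 * rho * eps <= delta ->
  2 * (expR (- (2 * pi ^+ 2 / delta ^+ 2)) - expR (- (8 * pi ^+ 2 / delta ^+ 2))) -
    rho * (64 * 1000 * M1 + 5200) * eps * (1 + delta ^+ 2)
  <= \int[P]_w (Z w * (Z w - quantizer delta (Z w))).
Proof.
move=> M1_gt0 approx delta_gt0 hdelta.
have rho_gt0 : 0 < rho := lt_le_trans ltr01 rho1.
have eps_gt0 : 0 < eps.
  rewrite lt_neqAle sumr_ge0 ?andbT; last by move=> i _; exact: exprn_ge0.
  apply/eqP => /esym/psumr_eq0P h; have := oner_neq0 R; rewrite -x1 big1 ?eqxx// => i _.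
  have : `|x i| ^+ 3 = 0 by apply: h => // j _; exact: exprn_ge0.
  by move/eqP; rewrite expf_eq0/= normr_eq0 => /eqP ->; rewrite expr0n.
have re : 0 < rho * eps by exact: mulr_gt0.
have p4 : pi < 4 :> R by have := pihalf_lt2 R; lra.
have p2 := pi_ge2 R.
pose kap := 64 * pi * (rho * eps).
have kap0 : 0 < kap by rewrite !mulr_gt0// pi_gt0.
have kap_le : kap <= 256 * (rho * eps).
  by rewrite ler_pM2r//; lra.
pose N := Num.truncn (delta / kap).
have X1 : 1 <= delta / kap by rewrite ler_pdivlMr// mul1r (le_trans kap_le)// mulrA.
have N_gt0 : (0 < N)%N by rewrite truncn_gt0.
have N1 : 1 <= N%:R :> R by rewrite ler1n.
have /andP[NX XN] := truncn_itv (le_trans ler01 X1); rewrite -/N in NX XN.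
have N_small : 32 * rho * eps * (2 * pi / delta * N%:R) <= 1.
  rewrite (_ : _ * _ = kap * N%:R / delta); last by rewrite /kap; ring.
  by rewrite ler_pdivrMr// mul1r mulrC -ler_pdivlMr.
have dN : delta / N%:R <= 512 * (rho * eps).
  rewrite ler_pdivrMr ?ltr0n//; rewrite ltr_pdivrMr// -natr1 in XN.
  have : (N%:R + 1) * kap <= (2 * N%:R) * (256 * (rho * eps)).
    by apply: ler_pM; rewrite ?(ltW kap0)//; lra.
  lra.
apply: le_trans (row_lower_bound M1_gt0 approx delta_gt0 N_gt0 N_small).
set A := expR _; set B := expR _.
have d2 : 0 < delta ^+ 2 by exact: exprn_gt0.
have n0 : 0 < N%:R :> R by lra.
have hA : A <= delta ^+ 2 / 8.
  have a0 : 0 < 2 * pi ^+ 2 / delta ^+ 2 by rewrite divr_gt0// mulr_gt0// exprn_gt0// pi_gt0.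
  rewrite /A expRN -[leRHS]invrK lef_pV2 ?posrE ?expR_gt0 ?invr_gt0 ?divr_gt0//.
  apply: le_trans (expR_ge1Dx _); rewrite invf_div.
  apply: (@le_trans _ _ (2 * pi ^+ 2 / delta ^+ 2)); last by lra.
  by rewrite ler_pM2r ?invr_gt0//; nra.
have e1 : 6 / N%:R ^+ 2 * A <= 192 * (rho * eps) * (1 + delta ^+ 2).
  have h1 : 6 / N%:R ^+ 2 <= 6 / N%:R :> R.
    by rewrite ler_pM2l// lef_pV2 ?posrE ?exprn_gt0// ler_eXnr.
  apply: (le_trans (ler_pM _ (expR_ge0 _) h1 hA)); first by rewrite divr_ge0 ?sqr_ge0.
  rewrite (_ : 6 / N%:R * (delta ^+ 2 / 8) = 3 / 4 * delta * (delta / N%:R)); last first.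
    by field; rewrite gt_eqF.
  have h2 : 3 / 4 * delta * (delta / N%:R) <= 3 / 4 * delta * (512 * (rho * eps)).
    by rewrite ler_wpM2l// mulr_ge0// ltW.
  apply: (le_trans h2); have := sqr_ge0 (delta - 1) => h3.
  have : 0 <= rho * eps * (delta - 1) ^+ 2 by rewrite mulr_ge0// ltW.
  lra.
have e2 : delta / (2 * pi) * (M1 / N%:R ^+ 2) * (N%:R * (6 + 500 * delta ^+ 2)) <=
    64 * 1000 * M1 * (rho * eps) * (1 + delta ^+ 2).
  have -> : delta / (2 * pi) * (M1 / N%:R ^+ 2) * (N%:R * (6 + 500 * delta ^+ 2)) =
     (2 * pi)^-1 * (delta / N%:R * M1 * (6 + 500 * delta ^+ 2)).
    have := pi_gt0 R; move: (@pi R) => p p0.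
    by field; rewrite !gt_eqF.
  have h1 : (2 * pi)^-1 <= 4^-1 :> R by rewrite lef_pV2 ?posrE ?mulr_gt0 ?pi_gt0//; lra.
  have h3 : 6 + 500 * delta ^+ 2 <= 500 * (1 + delta ^+ 2) by lra.
  have h4 : delta / N%:R * M1 <= 512 * (rho * eps) * M1 by rewrite ler_pM2r.
  have h5 : 0 <= delta / N%:R * M1 := ltW (mulr_gt0 (divr_gt0 delta_gt0 n0) M1_gt0).
  have h6 : 0 <= 6 + 500 * delta ^+ 2 by lra.
  have h7 : 0 <= (2 * pi)^-1 :> R by rewrite invr_ge0 mulr_ge0// pi_ge0.
  apply: (le_trans (ler_pM h7 (mulr_ge0 h5 h6) h1 (ler_pM h5 h6 h4 h3))).
  by rewrite le_eqVlt; apply/orP; left; apply/eqP; field.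
rewrite (_ : rho * (64 * 1000 * M1 + 5200) * eps * (1 + delta ^+ 2) =
   64 * 1000 * M1 * (rho * eps) * (1 + delta ^+ 2) + 192 * (rho * eps) * (1 + delta ^+ 2)
   + 5000 * rho * eps * delta ^+ 2 + (8 * (rho * eps) * (1 + delta ^+ 2) + 5000 * (rho * eps))); last by ring.
have : 0 <= 8 * (rho * eps) * (1 + delta ^+ 2) + 5000 * (rho * eps).
  have re1 : 0 <= rho * eps := ltW re.
  have red : 0 <= rho * eps * delta ^+ 2 := mulr_ge0 re1 (ltW d2).
  lra.
lra.
Qed.

End weighted_sum.

(** * From the hypotheses on the matrix to the bound *)

Section from_hypotheses.
Context d (T : measurableType d) (R : realType) (P : probability T R).

Lemma expectation_Rintegral (f : T -> R) : fine ('E_P[f])%E = \int[P]_w f w.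
Proof. by rewrite unlock. Qed.

Lemma psi2_third_moment (K : R) (z : {RV P >-> R}) : 0 < K ->
  (psi2_norm P z <= K%:E)%E ->
  intble P (fun w => `|z w| ^+ 3) /\
  \int[P]_w (`|z w| ^+ 3) <= (K / 3 `^ (- 2^-1)) ^+ 3.
Proof.
move=> K0 hK.
have c0 : 0 < 3 `^ (- 2^-1) :> R by rewrite powR_gt0.
have h3 : ((3 `^ (- 2^-1))%:E * 'N[P]_3%:E[EFin \o z] <= K%:E)%E.
  apply: le_trans hK; apply: ereal_sup_ubound; exists 3 => //=.
  by rewrite ler1n.
have pE w : (`| (EFin \o z) w | `^ 3)%E = (`|z w| ^+ 3)%:E.
  by rewrite /= -powR_mulrn.
move: h3; rewrite unlock.
under eq_integral do rewrite pE.
have I0 : (0 <= \int[P]_w (`|z w| ^+ 3)%:E)%E.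
  by apply: integral_ge0 => w _; rewrite lee_fin exprn_ge0.
have mz : measurable_fun setT (fun w => `|z w| ^+ 3).
  by apply: measurable_funX; apply: measurableT_comp.
rewrite /intble /Rintegral.
case iE : (\int[P]_w (`|z w| ^+ 3)%:E)%E I0 => [i||//] i0 /=.
  move=> h; split.
    apply/integrableP; split; first exact/measurable_EFinP.
    rewrite (_ : integral _ _ _ = (\int[P]_w (`|z w| ^+ 3)%:E)%E).
      by rewrite iE ltry.
    by apply: eq_integral => w _ /=; rewrite ger0_norm ?exprn_ge0.
  have {}i0 : 0 <= i by rewrite -lee_fin.
  have h' : i `^ 3^-1 <= K / 3 `^ (- 2^-1) by rewrite ler_pdivlMr// mulrC -lee_fin.
  rewrite [leLHS](_ : i = (i `^ 3^-1) ^+ 3); last first.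
    by rewrite -powR_mulrn ?powR_ge0// -powRrM mulVf// powRr1.
  by rewrite lerXn2r ?nnegrE ?powR_ge0// divr_ge0// ltW.
by rewrite invr_eq0 pnatr_eq0 /= gt0_muley ?lte_fin// leye_eq.
Qed.

Lemma standard_moments_intro (K rho : R) (z : {RV P >-> R}) : 0 < K ->
  (K / 3 `^ (- 2^-1)) ^+ 3 <= rho ->
  'E_P[z]%E = 0%E -> 'V_P[z]%E = 1%E -> (psi2_norm P z <= K%:E)%E ->
  standard_moments P z rho.
Proof.
move=> K0 hrho hE hV hK; have [I3 h3] := psi2_third_moment K0 hK.
split => //.
- by rewrite -(expectation_Rintegral z) hE.
- rewrite -(expectation_Rintegral (fun w => z w ^+ 2)) -[RHS]/(fine 1%:E) -hV; congr fine.
  rewrite /variance covariance.unlock hE; congr expectation.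
  by apply/funext => w; rewrite mulrfctE /= subr0.
- exact: le_trans hrho.
Qed.

Lemma independent_row m k (E : 'M[{RV P >-> R}]_(m, k)) (r : 'I_m) :
  mutually_independent (fun ij : 'I_m * 'I_k => E ij.1 ij.2) ->
  mutually_independent (fun j => E r j).
Proof.
move=> ind J A mA.
have inj : {in J &, injective (fun j : 'I_k => (r, j))} by move=> i j _ _ [].
have := ind [set (r, j) | j in J]%SET (fun ij => A ij.2).
rewrite big_imset//= => <-; last by move=> _ /imsetP[j jJ ->]; exact: mA.
congr (P _); apply/seteqP; split=> w /= h.
  by move=> _ /= /imsetP[j jJ ->]; exact: h.
by move=> j jJ; apply: (h (r, j)) => /=; apply/imsetP; exists j.
Qed.

Lemma dot_le_enorm k (x v : 'cV[R]_k) : enorm x = 1 ->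
  \sum_j x j 0 * v j 0 <= enorm v.
Proof.
move=> x1; have xx : \sum_j x j 0 ^+ 2 = 1.
  have := congr1 (fun a => a ^+ 2) x1; rewrite /enorm sqr_sqrtr ?expr1n//.
  by apply: sumr_ge0 => j _; exact: sqr_ge0.
set S := \sum_j _; apply: (le_trans (ler_norm _)).
rewrite -sqrtr_sqr ler_sqrt; last by apply: sumr_ge0 => j _; exact: sqr_ge0.
have : 0 <= \sum_j (v j 0 - S * x j 0) ^+ 2 by apply: sumr_ge0 => j _; exact: sqr_ge0.
rewrite (eq_bigr (fun j => v j 0 ^+ 2 + (- (2 * S) * (x j 0 * v j 0) + S ^+ 2 * x j 0 ^+ 2))).
  rewrite !big_split /= -!mulr_sumr xx -/S mulr1; lra.
by move=> j _; ring.
Qed.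

End from_hypotheses.

Lemma norm3_cube (R : realType) n (x : 'cV[R]_n) :
  norm3 x ^+ 3 = \sum_i `|x i 0| ^+ 3.
Proof.
rewrite /norm3 -powR_mulrn ?powR_ge0// -powRrM mulVf// powRr1//.
by apply: sumr_ge0 => i _; exact: exprn_ge0.
Qed.

Lemma msq_mu_ge (R : realType) (d : measure_display) (T : measurableType d)
    (P : probability T R) m k (E : 'M[{RV P >-> R}]_(m, k)) (delta L : R)
    (x : 'cV[R]_k) :
  (0 < m)%N -> 0 < delta -> enorm x = 1 ->
  (forall r j, intble P (E r j)) ->
  (forall r, let Z w := \sum_j x j 0 * E r j w in
     L <= \int[P]_w (Z w * (Z w - quantizer delta (Z w)))) ->
  L <= msq_mu E delta x.
Proof.
move=> m0 delta0 x1 IE hL; rewrite /msq_mu.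
set v := mx_expectation _ _.
pose Z r w := \sum_j x j 0 * E r j w.
pose err r w := Z r w - quantizer delta (Z r w).
have mZ r : measurable_fun setT (Z r).
  by apply: measurable_sum => j; apply: measurable_funM.
have Ierr r j : intble P (fun w => E r j w * err r w).
  apply: (@intbleMb _ _ _ _ _ _ (delta / 2)) => //.
    apply: measurable_funB => //.
    by apply: measurableT_comp => //; exact: measurable_quantizer.
  by move=> w; exact: quantizer_error_le.
have ZE w : realize E w *m x = \col_r Z r w.
  by apply/colP => r; rewrite !mxE; apply: eq_bigr => j _; rewrite mxE mulrC.
have vE j : v j 0 = \sum_r \int[P]_w (E r j w * err r w).
  rewrite mxE expectation_Rintegral -Rintegral_sum//.
  apply: eq_Rintegral => w _; rewrite ZE mxE; apply: eq_bigr => r _.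
  by rewrite !mxE.
have mr0 : 0 < m%:R :> R by rewrite ltr0n.
rewrite mulrC ler_pdivlMr//; apply: le_trans (dot_le_enorm _ x1).
have -> : \sum_j x j 0 * v j 0 = \sum_r \int[P]_w (Z r w * err r w).
  under eq_bigr do rewrite vE mulr_sumr.
  rewrite exchange_big /=; apply: eq_bigr => r _.
  rewrite (eq_bigr (fun j => \int[P]_w (x j 0 * (E r j w * err r w)))); last first.
    by move=> j _; rewrite RintegralZl//; exact: Ierr.
  rewrite -(Rintegral_sum (P := P)); last by move=> j _; exact: intbleZ.
  apply: eq_Rintegral => w _; rewrite /Z mulr_suml.
  by apply: eq_bigr => j _; rewrite mulrA.
apply: (@le_trans _ _ (\sum_(r < m) L)).
  by rewrite sumr_const card_ord mulr_natr.
by apply: ler_sum => r _; exact: hL.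
Qed.

Section error_budget.
Context (R : realType).
Variables rho M c0 eps delta Cr : R.
Hypotheses (rho1 : 1 <= rho) (M0 : 0 < M).
Hypotheses (c0_96 : 96 <= c0) (c0_rho : 384 * rho <= c0) (c0_M : 2 * M <= c0).
Hypotheses (eps0 : 0 <= eps) (delta0 : 0 < delta).

Let Q : R := Cr * (2 * Cr + 1) * (2 * Cr + 5) * delta ^+ 2.

Lemma c0_term_ge0 : 0 <= Cr -> 0 <= 3^-1 * c0 * eps * Q.
Proof.
move=> C0; have c00 : 0 <= c0 := le_trans (ler0n _ _) c0_96.
rewrite /Q; apply: mulr_ge0; first by apply: mulr_ge0 => //; exact: mulr_ge0.
apply: mulr_ge0; last exact: sqr_ge0.
by apply: mulr_ge0; [apply: mulr_ge0 => //|]; rewrite addr_ge0// mulr_ge0.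
Qed.

Hypotheses (C1 : 1 <= Cr) (Cd : 1 <= Cr * delta).

Let Qge : 4 * Cr * (Cr * delta) ^+ 2 <= Q.
Proof.
have C0 : 0 <= Cr := le_trans ler01 C1.
rewrite (_ : Q = 4 * Cr * (Cr * delta) ^+ 2 +
  (12 * Cr ^+ 2 + 5 * Cr) * delta ^+ 2); last by rewrite /Q; ring.
by rewrite lerDl mulr_ge0// ?sqr_ge0// addr_ge0// mulr_ge0// sqr_ge0.
Qed.

Let C3 : 1 <= Cr ^+ 3. Proof. exact: exprn_ege1. Qed.

Let Q1 : 4 <= Q.
Proof.
apply: le_trans Qge; rewrite -mulrA ler_peMr//.
by rewrite -[leLHS]mulr1; apply: ler_pM => //; exact: exprn_ege1.
Qed.

Let Q2 : 4 * delta ^+ 2 <= Q.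
Proof.
apply: le_trans Qge.
rewrite (_ : 4 * Cr * _ ^+ 2 = 4 * delta ^+ 2 * Cr ^+ 3); last by ring.
by rewrite ler_peMr// mulr_ge0// sqr_ge0.
Qed.

Let Q3 : 4 <= Q * delta.
Proof.
apply: le_trans (ler_wpM2r (ltW delta0) Qge).
rewrite (_ : 4 * Cr * _ * delta = 4 * (Cr * delta) ^+ 3); last by ring.
by rewrite ler_peMr// exprn_ege1.
Qed.

Lemma c0_term_large_eps : 1 / 64 <= eps -> 2 <= 3^-1 * c0 * eps * Q.
Proof.
move=> e1; have h1 : 96 * (1 / 64) <= c0 * eps by apply: ler_pM.
have h2 : 96 * (1 / 64) * 4 <= c0 * eps * Q by apply: ler_pM => //; exact: mulr_ge0.
by lra.
Qed.

Lemma c0_term_small_delta : delta <= 256 * rho * eps -> 2 <= 3^-1 * c0 * eps * Q.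
Proof.
move=> e2; have Q0 : 0 <= Q := le_trans (ler0n _ _) Q1.
have h1 : 384 * rho * (eps * Q) <= c0 * (eps * Q).
  by apply: ler_wpM2r => //; exact: mulr_ge0.
have h2 : Q * delta <= Q * (256 * rho * eps) by rewrite ler_wpM2l.
by have := Q3; lra.
Qed.

Lemma c0_term_absorbs : M * eps * (1 + delta ^+ 2) <= 3^-1 * c0 * eps * Q.
Proof.
have Q0 : 0 <= Q := le_trans (ler0n _ _) Q1.
have h0 : 0 <= eps * Q by exact: mulr_ge0.
have h1 : 2 * M * (eps * Q) <= c0 * (eps * Q) by apply: ler_wpM2r.
have h2 : M * eps * (2 * (1 + delta ^+ 2)) <= M * eps * Q.
  apply: ler_wpM2l; first by rewrite mulr_ge0// ltW.
  by have := Q1; have := Q2; lra.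
have h3 : 0 <= M * eps * Q by rewrite -mulrA mulr_ge0// ltW.
by lra.
Qed.

End error_budget.

Lemma trivial_bound (R : realDomainType) (a b t3 t4 t5 s : R) :
  a <= 1 -> 0 <= b -> 0 <= t5 -> 0 <= s -> 2 <= t3 + t4 ->
  2 * (a - b) - t3 - t4 - t5 <= s.
Proof. by move=> *; lra. Qed.

Theorem theorem3p10 (R : realType) (K : R) (K_gt0 : 0 < K) :
  exists c c0 : R, 0 < c /\ 0 < c0 /\
  forall (m k : nat) (delta : R) (x : 'cV[R]_k)
    (d : measure_display) (T : measurableType d) (P : probability T R)
    (E : 'M[{RV P >-> R}]_(m, k)),
    (0 < k)%N -> (0 < m)%N -> 3 < m%:R / k%:R :> R ->
    0 < delta ->
    enorm x = 1 ->
    iid (fun ij : 'I_m * 'I_k => E ij.1 ij.2) ->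
    (forall i j, ('E_P[E i j] = 0)%E) ->
    (forall i j, ('V_P[E i j] = 1)%E) ->
    (forall i j, sub_gaussian P (E i j)) ->
    (forall i j, (psi2_norm P (E i j) <= K%:E)%E) ->
    forall C : nat,
    2 * (expR (- (2 * pi ^+ 2 / delta ^+ 2)) -
         expR (- (8 * pi ^+ 2 / delta ^+ 2)))
    - 3^-1 * c0 * norm3 x ^+ 3
      * C%:R * (2 * C%:R + 1) * (2 * C%:R + 5) * delta ^+ 2
    - expR 1 * (K ^+ 2 / c) * expR (- (c * C%:R ^+ 2 * delta ^+ 2 / K ^+ 2))
    - 4 * expR (- (C%:R ^+ 2 * delta ^+ 2 / 2))
    <= msq_mu E delta x.
Proof.
have [M1 M1_gt0 approx] := quantizer_error_approx R.
pose B := (K / 3 `^ (- 2^-1)) ^+ 3.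
have B0 : 0 <= B by rewrite exprn_ge0// divr_ge0 ?powR_ge0// ltW.
have [rho rho1 rhoB] : exists2 rho : R, 1 <= rho & B <= rho.
  by exists (1 + B); [rewrite lerDl|rewrite lerDr].
have [M M0 ME] : exists2 M, 0 < M & M = rho * (64 * 1000 * M1 + 5200).
  have cst0 : 0 < 64 * 1000 * M1 + 5200 by lra.
  exists (rho * (64 * 1000 * M1 + 5200)); last by reflexivity.
  exact: (mulr_gt0 (lt_le_trans ltr01 rho1) cst0).
have [c0 [c0_96 c0_rho c0_M]] :
    exists c0, [/\ 96 <= c0, 384 * rho <= c0 & 2 * M <= c0].
  by clear ME; exists (96 + 384 * rho + 2 * M); split; lra.
have c0_gt0 : 0 < c0 := lt_le_trans (ltr0Sn _ _) c0_96.
have K2 : 0 < K ^+ 2 by exact: exprn_gt0.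
(* With c = K^2 / 2 the third term is at least 2 as soon as C delta < 1. *)
exists (K ^+ 2 / 2), c0; split; first exact: divr_gt0.
split=> //.
move=> m k delta x d T P E _ m0 _ delta0 x1 [ind _] hE hV _ hK C.
rewrite norm3_cube; set eps := \sum_i `|x i 0| ^+ 3.
have eps0 : 0 <= eps by apply: sumr_ge0 => i _; exact: exprn_ge0.
have mu0 : 0 <= msq_mu E delta x by rewrite mulr_ge0 ?invr_ge0 ?sqrtr_ge0.
set A1 := expR (- (2 * _ / _)); set A2 := expR (- (8 * _ / _)).
have A11 : A1 <= 1.
  rewrite expR_le1 oppr_le0; apply: divr_ge0; last exact: sqr_ge0.
  by apply: mulr_ge0 => //; exact: sqr_ge0.
have A20 : 0 <= A2 by exact: expR_ge0.
have -> : expR 1 * (K ^+ 2 / (K ^+ 2 / 2)) *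
    expR (- (K ^+ 2 / 2 * C%:R ^+ 2 * delta ^+ 2 / K ^+ 2)) =
    2 * expR (1 - (C%:R * delta) ^+ 2 / 2).
  rewrite (_ : - (K ^+ 2 / 2 * _ * _ / _) = - ((C%:R * delta) ^+ 2 / 2)); last first.
    by field; rewrite gt_eqF.
  rewrite (_ : K ^+ 2 / (K ^+ 2 / 2) = 2); last by field; rewrite gt_eqF.
  by rewrite expRD; ring.
set T4 := 2 * expR _; set T5 := 4 * expR _.
have T40 : 0 <= T4 by rewrite mulr_ge0// expR_ge0.
have T50 : 0 <= T5 by rewrite mulr_ge0// expR_ge0.
set T3 := 3^-1 * c0 * _ * _ * _ * _ * _.
have T3E : T3 = 3^-1 * c0 * eps *
    (C%:R * (2 * C%:R + 1) * (2 * C%:R + 5) * delta ^+ 2) by rewrite /T3; ring.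
have T30 : 0 <= T3 by rewrite T3E; apply: c0_term_ge0.
have [Cd|Cd] := ltP (C%:R * delta) 1.
  have Cd2 : (C%:R * delta) ^+ 2 <= 1 by rewrite exprn_ile1// ?mulr_ge0// ltW.
  apply: trivial_bound => //; apply: (@le_trans _ _ T4); last by rewrite lerDr.
  rewrite /T4 ler_pMr// -[leLHS]expR0 ler_expR subr_ge0 ler_pdivrMr// mul1r.
  by apply: (le_trans Cd2); rewrite ler1n.
have C1 : 1 <= C%:R :> R.
  rewrite ler1n lt0n; apply: contraTneq Cd => ->.
  by rewrite mul0r -ltNge ltr01.
have [e1|e1] := ltP (1 / 64) eps.
  apply: trivial_bound => //; apply: (@le_trans _ _ T3); last by rewrite lerDl.
  by rewrite T3E; apply: c0_term_large_eps => //; exact: ltW.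
have [e2|e2] := ltP delta (256 * rho * eps).
  apply: trivial_bound => //; apply: (@le_trans _ _ T3); last by rewrite lerDl.
  by rewrite T3E; apply: (c0_term_small_delta (rho := rho)) => //; exact: ltW.
have sm i j : standard_moments P (E i j) rho.
  by apply: (@standard_moments_intro _ _ _ _ K) => //; exact: rhoB.
have x2 : \sum_i x i 0 ^+ 2 = 1.
  have := congr1 (fun a => a ^+ 2) x1; rewrite /enorm sqr_sqrtr ?expr1n//.
  by apply: sumr_ge0 => j _; exact: sqr_ge0.
apply: (@le_trans _ _ (2 * (A1 - A2) - M * eps * (1 + delta ^+ 2))).
  apply: (@le_trans _ _ (2 * (A1 - A2) - T3)).
    by rewrite -!addrA lerD2l gerDl -opprD oppr_le0 addr_ge0.
  by rewrite lerB// T3E c0_term_absorbs.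
apply: (msq_mu_ge m0 delta0 x1) => [r j|r]; first exact: sm_int1 (sm r j).
rewrite ME.
exact: (@quantization_bias_lower _ _ _ _ _ (fun j => E r j) (fun j => x j 0)
  rho (independent_row r ind) (sm r) rho1 x2 e1 M1 delta M1_gt0 approx delta0 e2).
Qed.
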